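(* Let $(X,d)$ be a compact metric space with $\dim_{\mathrm{A}}(X,d)<\infty$. Then \[ \dim_{\mathrm{CA}}(X,d)=\mathrm{CE}(X,d)=\inf\{\dim_{\mathrm{A}}(X,\theta):\theta\in\mathcal J_p(X,d)\}. \] (Here $\mathrm{CE}(X,d)$ may be computed with any admissible choice of the parameters $a,\lambda,L>1$ and of the separated sets $X_k$, as described in the context.)
   Context: For a metric space $(X,d)$ and $A\subset X$, $N_r(A)$ is the minimal number of balls of radius $r$ needed to cover $A$. The Assouad dimension is $\dim_{\mathrm A}(X,d)=\inf\{\beta>0:\exists C>0,\ N_r(B(x,R))\le C(R/r)^\beta \text{ for all }x\in X,\,0<r<R\}$. A metric $d$ on $X$ is quasisymmetric to another metric $\theta$ on $X$ if there is a homeomorphism $\eta:[0,\infty)\to[0,\infty)$ with $\theta(x,a)/\theta(x,b)\le\eta(d(x,a)/d(x,b))$ for all $x,a,b\in X$, $x\ne b$; it is power quasisymmetric if $\eta$ can be taken of the form $\eta(t)=C(t^\alpha\vee t^{1/\alpha})$ with $C,\alpha\ge1$. The conformal gauge $\mathcal J(X,d)$ is the set of metrics $\theta$ on $X$ such that $d$ is quasisymmetric to $\theta$, and $\mathcal J_p(X,d)$ is the set of $\theta\in\mathcal J(X,d)$ that are power quasisymmetric to $d$. The conformal Assouad dimension is $\dim_{\mathrm{CA}}(X,d)=\inf\{\dim_{\mathrm A}(X,\theta):\theta\in\mathcal J(X,d)\}$. Combinatorial modulus: for a graph $G=(V,E)$ and a family $\Gamma$ of paths (finite sequences of vertices, consecutive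 ones adjacent), $\mathrm{Mod}_p(\Gamma,G)=\inf\{\sum_{v\in V}\rho(v)^p:\rho:V\to[0,\infty),\ \sum_{v\in\gamma}\rho(v)\ge1\ \forall\gamma\in\Gamma\}$, with $\mathrm{Mod}_p(\emptyset,G)=0$. Critical exponent: fix $a,\lambda,L>1$ and, for each $k\ge0$, a maximal $a^{-k}$-separated subset $X_k$ of $X$ (distinct points at mutual distance $\ge a^{-k}$, maximal for inclusion). Let $\mathcal S_k=\{(x,k):x\in X_k\}$, $\mathcal S=\bigcup_{k\ge0}\mathcal S_k$, $\pi_1(x,k)=x$, $\pi_2(x,k)=k$, $B_v=B(\pi_1(v),a^{-\pi_2(v)})$. Let $G_k$ be the graph with vertex set $\mathcal S_k$, distinct $v,w$ adjacent iff $B(\pi_1(v),\lambda a^{-k})\cap B(\pi_1(w),\lambda a^{-k})\ne\emptyset$. For $v\in\mathcal S$ and $k\in\mathbb N$, $\Gamma_{k,L}(v)$ is the set of paths $(v_1,\dots,v_n)$ in $G_{\pi_2(v)+k}$ with $\pi_1(v_1)\in B_v$ and $\pi_1(v_n)\notin B(\pi_1(v),La^{-\pi_2(v)})$. Set $M_{p,k}(L)=\sup_{v\in\mathcal S}\mathrm{Mod}_p(\Gamma_{k,L}(v),G_{\pi_2(v)+k})$, $M_p(L)=\liminf_{k\to\infty}M_{p,k}(L)$, and $\mathrm{CE}(X,d)=\inf\{p>0:M_p(L)=0\}$. *)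

(* Defs.v *)
From HB Require Import structures.
From mathcomp Require Import all_boot all_order all_algebra.
From mathcomp Require Import all_classical all_reals all_analysis.
Set Implicit Arguments. Unset Strict Implicit. Unset Printing Implicit Defensive.
Import Order.TTheory GRing.Theory Num.Theory.
Import numFieldNormedType.Exports.
Local Open Scope classical_set_scope.
Local Open Scope ring_scope.

Section Defs.
Context {R : realType} {X : choiceType}.

Definition is_metric (d : X -> X -> R) : Prop :=
  [/\ forall x y, 0 <= d x y,
      forall x y, d x y = 0 <-> x = y,
      forall x y, d x y = d y x &
      forall x y z, d x z <= d x y + d y z].

Definition dball (d : X -> X -> R) (x : X) (r : R) : set X := [set y | d x y < r].

Definition d_open (d : X -> X -> R) (U : set X) : Prop :=
  forall x, U x -> exists2 e : R, 0 < e & dball d x e `<=` U.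

Definition d_compact (d : X -> X -> R) : Prop :=
  forall C : set (set X), C `<=` d_open d -> [set: X] `<=` \bigcup_(U in C) U ->
    exists2 F : set (set X), finite_set F & F `<=` C /\ [set: X] `<=` \bigcup_(U in F) U.

Definition cov_num (d : X -> X -> R) (A : set X) (r : R) : \bar R :=
  ereal_inf [set ((size s)%:R)%:E | s in
    [set s : seq X | A `<=` [set y | exists2 c, c \in s & dball d c r y]]].

Definition dimA (d : X -> X -> R) : \bar R :=
  ereal_inf [set b%:E | b in [set b : R | 0 < b /\
     exists2 C : R, 0 < C & forall (x : X) (r Rr : R), 0 < r -> r < Rr ->
       (cov_num d (dball d x Rr) r <= (C * powR (Rr / r) b)%:E)%E]].

Definition homeo_nonneg (eta : R -> R) : Prop :=
  exists etai : R -> R,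
    [/\ forall t, 0 <= t -> [/\ 0 <= eta t, 0 <= etai t,
                                 etai (eta t) = t & eta (etai t) = t],
        {within [set t : R | 0 <= t], continuous eta} &
        {within [set t : R | 0 <= t], continuous etai}].

Definition quasisymmetric (d theta : X -> X -> R) : Prop :=
  exists2 eta : R -> R, homeo_nonneg eta &
    forall x a b : X, x <> b -> theta x a / theta x b <= eta (d x a / d x b).

Definition power_quasisymmetric (d theta : X -> X -> R) : Prop :=
  exists C alpha : R, [/\ 1 <= C, 1 <= alpha &
    forall x a b : X, x <> b ->
      theta x a / theta x b <=
        C * Num.max (powR (d x a / d x b) alpha) (powR (d x a / d x b) alpha^-1)].

Definition gauge (d : X -> X -> R) : set (X -> X -> R) :=
  [set theta | is_metric theta /\ quasisymmetric d theta].

Definition gauge_p (d : X -> X -> R) : set (X -> X -> R) :=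
  [set theta | gauge d theta /\ power_quasisymmetric d theta].

Definition dimCA (d : X -> X -> R) : \bar R :=
  ereal_inf [set dimA theta | theta in gauge d].

Definition separated (d : X -> X -> R) (t : R) (Y : set X) : Prop :=
  forall x y, Y x -> Y y -> x <> y -> t <= d x y.

Definition maximal_separated (d : X -> X -> R) (t : R) (Y : set X) : Prop :=
  separated d t Y /\ forall Z, Y `<=` Z -> separated d t Z -> Z = Y.

Section Graphs.
Variables (d : X -> X -> R) (a lam : R) (Xs : nat -> set X).

(* adjacency in G_k (vertices identified with points of X_k) *)
Definition adjG (k : nat) (x y : X) : Prop :=
  x <> y /\ exists z, dball d x (lam * a ^- k) z /\ dball d y (lam * a ^- k) z.

Fixpoint path_from (k : nat) (x : X) (rest : seq X) : Prop :=
  match rest with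
  | [::] => True
  | y :: rest' => [/\ Xs k y, adjG k x y & path_from k y rest']
  end.

Definition is_pathG (k : nat) (g : X * seq X) : Prop :=
  Xs k g.1 /\ path_from k g.1 g.2.

Definition path_verts (g : X * seq X) : set X :=
  [set v | v = g.1 \/ v \in g.2].

Definition GammaKL (L : R) (k : nat) (x : X) (m : nat) : set (X * seq X) :=
  [set g | is_pathG (m + k) g /\ dball d x (a ^- m) g.1 /\
           ~ dball d x (L * a ^- m) (last g.1 g.2)].

Definition modG (p : R) (n : nat) (Gam : set (X * seq X)) : \bar R :=
  ereal_inf [set (\sum_(v \in Xs n) powR (rho v) p)%:E | rho in
    [set rho : X -> R | (forall v, 0 <= rho v) /\
        forall g, Gam g -> 1 <= \sum_(v \in path_verts g) rho v]].

Definition Mpk (p L : R) (k : nat) : \bar R :=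
  ereal_sup [set modG p (xm.2 + k) (GammaKL L k xm.1 xm.2) | xm in
     [set xm : X * nat | Xs xm.2 xm.1]].

Definition Mp (p L : R) : \bar R := limn_einf (fun k => Mpk p L k).

Definition CE (L : R) : \bar R :=
  ereal_inf [set p%:E | p in [set p : R | 0 < p /\ Mp p L = 0%E]].

End Graphs.
End Defs.

(* Main.v *)
(** Lower bound for the conformal dimension: if [theta] is in the gauge and [p > dim_A theta],
the weight giving to a vertex [w] of [G_{m+k}] the [theta]-diameter of a neighbourhood of [w],
divided by the [theta]-size of [B_v], is admissible up to a constant.  Neighbourhoods of size about
[e^-i] are [theta]-separated at that scale, so there are at most [C e^(b i)] of them with
[dim_A theta < b < p], and the [p]-sum is a geometric tail that vanishes as [k] grows.

Upper bound: if [M_p = 0], fix a step [k] with [M_{p,k}] tiny and almost optimal weights [rho_v].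
Define masses by [mu_0 = 1] and
[mu_{n+1}(x) = sum_v sum_u mu_n(v) rho_v(u)^p exp(1 - d(x,u)/s_n)],
where [u] runs over the net of scale [s_n].  The recursion is linear and smoothing: [log mu_n] is
Lipschitz at scale [n], [mu_{n+1}/mu_n] stays in a compact subset of [(0, 1)], and the mass of
a ball at least halves from one level to the next.  With [pi_n = mu_n^(1/p)], let [theta] be the
infimum of the lengths of chains whose steps of level [n] have size at most [a^(-k n)] and cost
about [pi_n].  Admissibility of [rho_v] allows one to trade a run of steps of level [n+1] leaving
[B(v, L r_n)] for a single step of level [n] at [v], at no extra cost; eliminating fine levels in
this way gives [theta(x,y) ~ pi_n(x)] when [d(x,y) ~ a^(-k n)].  Hence [theta] is power
quasisymmetric to [d], and since the total mass of all levels below a given ball converges,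
[dim_A theta <= p]. *)
Require Import Defs.
From HB Require Import structures.
From mathcomp Require Import all_boot all_order all_algebra.
From mathcomp Require Import all_classical all_reals all_analysis.
From mathcomp Require Import ring lra.
Import Order.TTheory GRing.Theory Num.Theory.
Local Open Scope classical_set_scope.
Local Open Scope ring_scope.
Set Implicit Arguments. Unset Strict Implicit. Unset Printing Implicit Defensive.

(** * Counting in doubling spaces *)

Section General.
Context {R : realType}.
Implicit Types x y : R.

Lemma powR_le_expR (b c : R) : 0 < b -> 0 < c ->
  exists2 C : R, 0 < C & forall y, 0 < y -> powR y b <= C * expR (c * y).
Proof.
move=> b0 c0; exists (expR (- b * ln (c / b))); first exact: expR_gt0.
move=> y y0; rewrite -expRD /powR (gt_eqF y0) ler_expR.
have cb0 : 0 < c / b by rewrite divr_gt0.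
(* The tangent inequality [ln z <= z - 1] at [z = c / b * y]: multiplied by [b], it has slope
   exactly [c] in [y]. *)
have : ln (c / b * y) <= c / b * y - 1.
  have {1}-> : c / b * y = 1 + (c / b * y - 1) by ring.
  by apply: le_ln1Dx; rewrite ltrBrDr addNr mulr_gt0.
rewrite lnM ?posrE // => h.
have : b * (ln (c / b) + ln y) <= b * (c / b * y - 1) by rewrite ler_pM2l.
have -> : b * (c / b * y - 1) = c * y - b by field; rewrite gt_eqF.
lra.
Qed.

Lemma geometric_sum_le (q : R) (N : nat) : 0 <= q -> q < 1 ->
  \sum_(i < N) q ^+ i <= (1 - q)^-1.
Proof.
move=> q0 q1; have h : 0 < 1 - q by rewrite subr_gt0.
rewrite -[leRHS]mul1r ler_pdivlMr //.
have -> : (\sum_(i < N) q ^+ i) * (1 - q) = 1 - q ^+ N.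
  have := subrX1 q N; move/(congr1 (fun u => - u)).
  by rewrite opprB => ->; ring.
by rewrite gerBl exprn_ge0.
Qed.

(** Group the terms by the integer part [i] of [h w]: a layer has at most [C * expR (b * (i + 1))]
    terms, each at most [expR (- t * i)], and the layers sum to a geometric series of ratio
    [expR (b - t) < 1]. *)
Lemma layer_sum (T : eqType) (s : seq T) (h : T -> R) (C b t : R) :
  0 <= C -> 0 < t -> b < t -> {in s, forall w, 0 <= h w} ->
  (forall i : nat,
     (count (fun w => h w < i.+1%:R) s)%:R <= C * expR (b * i.+1%:R)) ->
  \sum_(w <- s) expR (- t * h w) <= C * expR b / (1 - expR (b - t)).
Proof.
move=> C0 t0 bt h0 hc.
pose N := (\max_(w <- s) (Num.trunc (h w)).+1)%N.
have step w : w \in s ->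
    expR (- t * h w) <= \sum_(i < N) (h w < i.+1%:R)%R%:R * expR (- t * i%:R).
  move=> ws; have /andP[h1 h2] := truncn_itv (h0 _ ws).
  have lt : (Num.trunc (h w) < N)%N by rewrite /N (big_rem w) //= leq_max leqnn.
  rewrite (bigD1 (Ordinal lt)) //= h2 mul1r.
  rewrite -[leLHS]addr0; apply: lerD.
    by rewrite ler_expR !mulNr lerN2 ler_pM2l.
  by apply: sumr_ge0 => i _; rewrite mulr_ge0 // expR_ge0.
apply: (@le_trans _ _ (\sum_(w <- s) \sum_(i < N) (h w < i.+1%:R)%R%:R * expR (- t * i%:R))).
  by rewrite big_seq [leRHS]big_seq; apply: ler_sum => w /step.
rewrite exchange_big /=.
apply: (@le_trans _ _ (\sum_(i < N) C * expR b * expR (b - t) ^+ i)).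
  apply: ler_sum => i _; rewrite -mulr_suml -natr_sum.
  pose P w := h w < i.+1%:R.
  have -> : (\sum_(w <- s) P w)%N = count P s.
    by rewrite -sum1_count [RHS]big_mkcond /=; apply: eq_bigr => w _; case: ifP.
  apply: (le_trans (ler_wpM2r (expR_ge0 _) (hc i))).
  rewrite -!mulrA ler_wpM2l // -expRM_natr -!expRD ler_expR -natr1; lra.
rewrite -mulr_sumr ler_wpM2l ?mulr_ge0 ?expR_ge0 // geometric_sum_le ?expR_ge0 //.
by rewrite -expR0 ltr_expR subr_lt0.
Qed.
End General.

Section MetricFacts.
Context {R : realType} {X : choiceType} (d : X -> X -> R).
Hypothesis dm : is_metric d.

Lemma metric_ge0 x y : 0 <= d x y. Proof. by case: dm. Qed.
Lemma metric_self x : d x x = 0. Proof. by case: dm => _ h _ _; apply/h. Qed.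
Lemma metric_sym x y : d x y = d y x. Proof. by case: dm. Qed.
Lemma metric_triangle y x z : d x z <= d x y + d y z. Proof. by case: dm. Qed.
Lemma metric_gt0 x y : x <> y -> 0 < d x y.
Proof.
move=> xy; rewrite lt_neqAle metric_ge0 andbT eq_sym; apply/eqP => e; apply: xy.
by case: dm => _ h _ _; apply/h.
Qed.

Definition assouad_bound (C b : R) := forall (x : X) (r Rr : R), 0 < r -> r < Rr ->
  (cov_num d (dball d x Rr) r <= (C * powR (Rr / r) b)%:E)%E.

(** Sending each point of [s] to the centre of a ball containing it is injective, since two points
    of one [t]-ball are less than [2 * t] apart. *)
Lemma separated_size_le_cover (A : set X) (t : R) (s c : seq X) :
  uniq s -> {in s &, forall u v, u <> v -> 2 * t <= d u v} ->
  {in s, forall u, A u} ->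
  A `<=` [set y | exists2 z, z \in c & dball d z t y] -> (size s <= size c)%N.
Proof.
move=> us sep sA cov.
have /choice[f fP] : forall w, exists z, w \in s -> z \in c /\ d z w < t.
  move=> w; case: (boolP (w \in s)) => [ws|_]; last by exists w.
  by have [z zc zw] := cov _ (sA _ ws); exists z.
have fi : {in s &, injective f}.
  move=> u v us' vs e; apply: contrapT => uv; have := sep _ _ us' vs uv.
  have [_ h1] := fP _ us'; have [_ h2] := fP _ vs; rewrite e in h1.
  have := metric_triangle (f v) u v; rewrite (metric_sym u (f v)); lra.
rewrite -(size_map f); apply: uniq_leq_size; first by rewrite map_inj_in_uniq.
by move=> z /mapP[w ws ->]; case: (fP _ ws).
Qed.

Lemma separated_size_le (C b : R) (x : X) (Rr t : R) (s : seq X) :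
  assouad_bound C b -> uniq s -> {in s &, forall u v, u <> v -> 2 * t <= d u v} ->
  {in s, forall u, d x u < Rr} -> 0 < t -> t < Rr ->
  (size s)%:R <= C * powR (Rr / t) b.
Proof.
move=> ab us sep sA t0 tR; rewrite -lee_fin; apply: le_trans (ab x t Rr t0 tR).
apply: le_ereal_inf_tmp => _ [c cov <-]; rewrite lee_fin ler_nat.
exact: (separated_size_le_cover us sep sA cov).
Qed.

Lemma assouad_bound_of_dimA : (dimA d < +oo)%E ->
  exists b C : R, [/\ 0 < b, 0 < C & assouad_bound C b].
Proof.
move=> /ereal_inf_lt[_ [b [b0 [C C0 h]] <-] _]; by exists b, C.
Qed.

Lemma compact_bounded : d_compact d -> exists D : R, forall x y, d x y < D.
Proof.
move=> dc; case: (pselect (exists x : X, True)) => [[x0 _]|nX]; last first.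
  by exists 0 => x; case: nX; exists x.
have [] := dc [set U | exists n : nat, U = dball d x0 n%:R].
- move=> _ [n ->] x xn; exists (n%:R - d x0 x); first by rewrite subr_gt0.
  move=> y; rewrite /dball /= => h; have := metric_triangle x x0 y; lra.
- move=> x _; exists (dball d x0 (Num.trunc (d x0 x)).+1%:R); first by eexists.
  by have /andP[] := truncn_itv (metric_ge0 x0 x).
move=> F /finite_seqP[s ->] [sub cov].
have [n nP] : exists n : nat, forall U, U \in s -> U `<=` dball d x0 n%:R.
  have {cov} : {in s, forall U, exists n : nat, U = dball d x0 n%:R}.
    by move=> U Us; apply: sub.
  elim: s {sub} => [|U s ih] h; first by exists 0%N.
  have [n nP] : exists n : nat, forall U, U \in s -> U `<=` dball d x0 n%:R.
    by apply: ih => V Vs; apply: h; rewrite inE Vs orbT.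
  have [m mP] := h U (mem_head _ _).
  exists (maxn n m) => V; rewrite inE => /orP[/eqP-> y|Vs y].
    by rewrite mP /dball /= => hy; apply: (lt_le_trans hy); rewrite ler_nat leq_maxr.
  by move/(nP _ Vs); rewrite /dball /= => hy; apply: (lt_le_trans hy); rewrite ler_nat leq_maxl.
exists (n%:R + n%:R) => x y.
have hb z : d x0 z < n%:R.
  by have [U Us Uz] := cov z I; apply: (nP U).
by have := hb x; have := hb y; have := metric_triangle x0 x y; rewrite (metric_sym x x0); lra.
Qed.

(** The whole space is one ball, which the Assouad bound covers by finitely many balls of radius
    [t / 2]; each of them holds at most one point of [A]. *)
Lemma separated_finite (C b t : R) (A : set X) : d_compact d -> assouad_bound C b ->
  0 < t -> Defs.separated d t A -> exists2 s : seq X, uniq s & A = [set` s].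
Proof.
move=> dc ab t0 sep.
have [D hD] := compact_bounded dc.
have [[x0 _]|nX] := pselect (exists x : X, True); last first.
  by exists [::] => //; apply/seteqP; split => // x; case: nX; exists x.
pose Rr := Num.max D t.
have t2 : 0 < t / 2 by lra.
have hR : t / 2 < Rr by rewrite /Rr lt_max; apply/orP; right; lra.
have [c cov] : exists c : seq X,
    dball d x0 Rr `<=` [set y | exists2 z, z \in c & dball d z (t / 2) y].
  have /ereal_inf_lt[_ [c cov _] _] : (cov_num d (dball d x0 Rr) (t / 2) < +oo)%E.
    by apply: (le_lt_trans (ab _ _ _ t2 hR)); rewrite ltry.
  by exists c.
have cv x : exists2 z, z \in c & d z x < t / 2.
  by apply: cov; rewrite /dball /= /Rr lt_max hD.
have /choice[f fP] : forall z, exists y, (exists2 y, A y & d z y < t / 2) -> A y /\ d z y < t / 2.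
  move=> z; have [[y Ay yz]|n] := pselect (exists2 y, A y & d z y < t / 2); first by exists y.
  by exists z.
have fA : A `<=` [set` map f c].
  move=> y Ay; have [z zc zy] := cv y.
  have [Af fz] : A (f z) /\ d z (f z) < t / 2 by apply: fP; exists y.
  apply/mapP; exists z => //; apply: contrapT => ne.
  have := sep _ _ Ay Af ne; have := metric_triangle z y (f z); rewrite (metric_sym y z); lra.
have /finite_seqP[s ->] : finite_set A by apply: sub_finite_set fA _; exact: finite_seq.
by exists (undup s); rewrite ?undup_uniq //; apply/seteqP; split => y /=; rewrite mem_undup.
Qed.

Lemma maximal_separated_cover (t : R) (A : set X) : 0 < t -> maximal_separated d t A ->
  forall x, exists2 y, A y & d x y < t.
Proof.
move=> t0 [sep mx] x; have [Ax|nAx] := pselect (A x).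
  by exists x => //; rewrite metric_self.
apply: contrapT => nc; apply: nAx.
have -> : A = A `|` [set x].
  apply/esym/mx; first by move=> y; left.
  have far y : A y -> t <= d x y.
    by move=> Ay; rewrite leNgt; apply/negP => xy; apply: nc; exists y.
  move=> y z [Ay|->] [Az|->] // yz; first exact: sep.
  - by rewrite metric_sym; apply: far.
  - exact: far.
by right.
Qed.

End MetricFacts.

(** * Homeomorphisms of the half-line *)

Section Homeo.
Context {R : realType} (eta : R -> R).
Hypothesis hom : homeo_nonneg eta.

Lemma homeo_nonneg_mono s t : 0 <= s -> 0 <= t -> (eta s <= eta t) = (s <= t).
Proof.
case: hom => ei [h ce _] s0 t0.
have e : [set t : R | 0 <= t] = [set` `[0, +oo[%R].
  by apply/seteqP; split => u /=; rewrite in_itv /= andbT.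
rewrite e in ce.
have := @itv_continuous_inj_le R eta `[0, +oo[%R _ ce _.
move=> H; apply: H; rewrite ?in_itv /= ?s0 ?t0 //.
(* A continuous injection of an interval is monotone; this pair of points, where [eta] grows by 1,
   excludes the decreasing case. *)
- exists 0, (ei (eta 0 + 1)); rewrite !in_itv /= !andbT.
  have [h0 _ _ _] := h 0 (lexx _).
  have h1 : 0 <= eta 0 + 1 by rewrite addr_ge0.
  have [_ h2 _ h3] := h _ h1; rewrite h3 h2 lexx; split => //; last by rewrite lerDl.
  rewrite lt_neqAle h2 andbT; apply/eqP => e0; move: h3; rewrite -e0; lra.
- move=> u v; rewrite !in_itv /= !andbT => u0 v0 uv.
  by have [_ _ <- _] := h _ u0; have [_ _ <- _] := h _ v0; rewrite uv.
Qed.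

Lemma homeo_nonneg_ge0 t : 0 <= t -> 0 <= eta t.
Proof. by case: hom => ei [h _ _] /h[]. Qed.

Lemma homeo_nonneg_small e : 0 < e -> exists2 t, 0 < t & eta t <= e.
Proof.
case: hom => ei [h _ _] e0; have [_ h2 _ h3] := h _ (ltW e0).
have [t0|t0] := ltP 0 (ei e); first by exists (ei e); rewrite ?h3.
have z : ei e = 0 by apply/le_anti; rewrite t0 h2.
have [_ h4 h5 h6] := h 0 (lexx _).
have := homeo_nonneg_mono (lexx 0) h4; rewrite h6 h4 -[in eta 0]z h3 leNgt e0; by [].
Qed.

End Homeo.

Section Nets.
Context {R : realType} {X : choiceType} (d : X -> X -> R) (a : R) (Y : nat -> seq X).
Hypothesis dm : is_metric d.
Hypothesis a1 : 1 < a.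
Hypothesis Yuniq : forall n, uniq (Y n).
Hypothesis Ysep : forall n, {in Y n &, forall u v, u <> v -> a ^- n <= d u v}.

(** Layers of [d x u * a ^+ n] have polynomial size by the Assouad bound, hence at most exponential
    size of rate [t / 2 < t]. The bound is uniform in the level and the base point. *)
Lemma exp_sum_bound (C b : R) : 0 < C -> 0 < b -> assouad_bound d C b ->
  forall t, 0 < t -> exists2 M, 0 < M &
    forall n x, \sum_(u <- Y n) expR (- t * (d x u * a ^+ n)) <= M.
Proof.
move=> C0 b0 ab t t0.
have t4 : 0 < t / 4 by lra.
have [C' C'0 hC'] := powR_le_expR b0 t4.
have an n : 0 < a ^+ n by rewrite exprn_gt0 // (lt_trans ltr01).
have th : t / 2 - t < 0 by lra.
exists (C * C' * expR (t / 2) / (1 - expR (t / 2 - t))).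
  rewrite divr_gt0 ?mulr_gt0 ?expR_gt0 // subr_gt0 -[ltRHS]expR0 ltr_expR; exact: th.
move=> n x; apply: layer_sum => //; [| by lra | |].
- by rewrite mulr_ge0 // ltW.
- by move=> u _; rewrite mulr_ge0 ?(metric_ge0 dm) // ltW.
move=> i; rewrite -size_filter.
have i0 : 0 < i.+1%:R :> R by rewrite ltr0n.
have i1 : 1 <= i.+1%:R :> R by rewrite ler1n.
have v0 : 0 < a ^- n by rewrite invr_gt0.
have := @separated_size_le R X d dm C b x (i.+1%:R / a ^+ n) (a ^- n / 2)
  [seq u <- Y n | d x u * a ^+ n < i.+1%:R] ab _ _ _ _ _.
have e : i.+1%:R / a ^+ n / (a ^- n / 2) = 2 * i.+1%:R.
  by field; rewrite gt_eqF.
rewrite e => h.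
apply: (@le_trans _ _ (C * powR (2 * i.+1%:R) b)).
  apply: h.
  - exact: filter_uniq.
  - move=> u v; rewrite !mem_filter => /andP[_ ?] /andP[_ ?] uv.
    by rewrite mulrC divfK ?pnatr_eq0 //; apply: Ysep.
  - by move=> u; rewrite mem_filter ltr_pdivlMr // => /andP[].
  - lra.
  - have : a ^- n <= i.+1%:R / a ^+ n by rewrite ler_pMl.
    lra.
rewrite -mulrA ler_pM2l //.
have := hC' (2 * i.+1%:R) ltac:(lra).
by have -> : t / 4 * (2 * i.+1%:R) = t / 2 * i.+1%:R by field.
Qed.

End Nets.

(** * Paths and their vertex sums *)

Section Paths.
Context {R : realType} {X : choiceType}.

Lemma path_verts_sum (g : X * seq X) (f : X -> R) :
  \sum_(v \in path_verts g) f v = \sum_(v <- undup (g.1 :: g.2)) f v.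
Proof.
have -> : path_verts g = [set` undup (g.1 :: g.2)].
  have e v : (v \in undup (g.1 :: g.2)) = (v == g.1) || (v \in g.2).
    by rewrite mem_undup inE.
  apply/seteqP; split => v; last by move/[dup]; rewrite {1}/mkset e => /orP[/eqP->|]; [left|right].
  by case=> [->|vg]; rewrite /mkset e ?eqxx ?vg ?orbT.
by rewrite -fsbig_seq // undup_uniq.
Qed.

Lemma sum_undup_le (s : seq X) (f : X -> R) : (forall v, 0 <= f v) ->
  \sum_(v <- undup s) f v <= \sum_(v <- s) f v.
Proof.
move=> f0; elim: s => [|u s ih] /=; first by rewrite big_nil.
case: ifP => _; rewrite ?big_cons ?lerD2l //.
by apply: (le_trans ih); rewrite lerDr.
Qed.

Lemma path_fromP (d : X -> X -> R) a lam (Xs : nat -> set X) k x p :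
  path_from d a lam Xs k x p <->
  path (fun u v => `[< Xs k v /\ adjG d a lam k u v >]) x p.
Proof.
elim: p x => [|y p ih] x /=; first by split.
split; first by case=> h1 h2 /ih ->; rewrite andbT; apply/asboolP.
by case/andP => /asboolP[h1 h2] /ih.
Qed.

(** Cut the path at its first vertex outside [P], then remove the loops. Only the last vertex is
    outside [P], and it is one edge away from [P]. *)
Lemma simple_exit (e : rel X) (P : pred X) x p :
  path e x p -> P x -> ~~ P (last x p) ->
  exists p', [/\ path e x p', uniq (x :: p'), {subset x :: p' <= x :: p}, ~~ P (last x p') &
    {in x :: p', forall w, P w \/ exists2 u, P u & e u w}].
Proof.
move=> xp Px nP.
have [q [xq sub nq inq]] : exists p', [/\ path e x p', {subset x :: p' <= x :: p},
    ~~ P (last x p') & {in x :: p', forall w, P w \/ exists2 u, P u & e u w}].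
  elim: p x xp Px nP => [|y p ih] x /= xp Px nP; first by rewrite Px in nP.
  case/andP: xp => xy yp; case: (boolP (P y)) => Py; last first.
    exists [:: y]; rewrite /= xy; split => //.
      by move=> w; rewrite !inE => /orP[->|/eqP->] //; rewrite eqxx orbT.
    by move=> w; rewrite !inE => /orP[/eqP->|/eqP->]; [left|right; exists x].
  have [q [yq sub nq inq]] := ih y yp Py nP.
  exists (y :: q); rewrite /= xy; split => //.
    by move=> w; rewrite inE => /orP[/eqP->|/sub h]; rewrite inE ?eqxx // h orbT.
  by move=> w; rewrite inE => /orP[/eqP->|/inq //]; left.
case/shortenP: xq nq => q' xq' uq' sq' nq.
have s : {subset x :: q' <= x :: q}.
  by move=> w; rewrite !inE => /orP[->//|/sq' ->]; rewrite orbT.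
by exists q'; split => // w /s; [apply: sub|apply: inq].
Qed.

End Paths.

(** * Modulus above the Assouad dimension of a metric in the gauge *)

Section Misc.
Context {R : realType}.

Lemma ler_sum_uniq_sub (T : choiceType) (s1 s2 : seq T) (f : T -> R) :
  uniq s1 -> uniq s2 -> {subset s1 <= s2} -> (forall v, 0 <= f v) ->
  \sum_(v <- s1) f v <= \sum_(v <- s2) f v.
Proof.
move=> u1 u2 sub f0; rewrite [leRHS](bigID (mem s1)) /= -[leLHS]addr0.
apply: lerD; last by apply: sumr_ge0.
rewrite -[leRHS]big_filter; rewrite (perm_big [seq v <- s2 | v \in s1]) //.
apply: uniq_perm; rewrite ?filter_uniq // => v; rewrite mem_filter.
by case: (boolP (v \in s1)) => // /sub ->.
Qed.

Lemma exprV_small (a e : R) : 1 < a -> 0 < e -> exists K, forall k, (K <= k)%N -> a ^- k <= e.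
Proof.
move=> a1 e0; have a0 : 0 < a by lra.
pose c := a - 1; have c0 : 0 < c by rewrite /c; lra.
have bern k : k%:R * c <= a ^+ k.
  elim: k => [|k ih]; first by rewrite mul0r.
  have k1 : 1 <= a ^+ k by apply: exprn_ege1; rewrite ltW.
  have : 1 * c <= a ^+ k * c by rewrite ler_pM2r.
  by move: ih; rewrite exprSr -natr1 /c; lra.
exists (Num.trunc ((c * e)^-1)).+1 => k Kk.
have ce0 : 0 < (c * e)^-1 by rewrite invr_gt0 mulr_gt0.
have /andP[_ h] := truncn_itv (ltW ce0).
have h2 : (c * e)^-1 < k%:R by apply: (lt_le_trans h); rewrite ler_nat.
rewrite -[e]invrK lef_pV2 ?posrE ?exprn_gt0 ?invr_gt0 //; apply: le_trans (bern k).
have := ltW h2; rewrite invfM => h3; have : c * (c^-1 / e) <= c * k%:R by rewrite ler_pM2l.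
by rewrite mulrA mulfV ?gt_eqF // mul1r mulrC.
Qed.

Lemma limn_einf_eq0 (u : nat -> \bar R) : (forall n, (0 <= u n)%E) ->
  (limn_einf u = 0)%E <->
  (forall (e : R) N, 0 < e -> exists2 k, (N <= k)%N & (u k < e%:E)%E).
Proof.
move=> u0; have E : limn_einf u = ereal_sup (range (einfs u)).
  by rewrite limn_einf_lim; apply/cvg_lim => //; exact: cvg_einfs_sup.
have u0' n : (0 <= einfs u n)%E by apply: le_ereal_inf_tmp => _ [k _ <-].
split => [h e N e0|h].
  have : (einfs u N < e%:E)%E.
    apply: (@le_lt_trans _ _ 0%E); last by rewrite lte_fin.
    by rewrite -h E; apply: ereal_sup_ubound; exists N.
  by move=> /ereal_inf_lt[_ [k Nk <-] uk]; exists k.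
apply/le_anti/andP; split; last first.
  by rewrite E; apply: le_ereal_sup_tmp; exists (einfs u 0%N) => //; exists 0%N.
rewrite E; apply: ge_ereal_sup => _ [n _ <-].
apply/lee_addgt0Pr => e e0; rewrite add0e; have [k nk uk] := h e n e0.
by apply: ge_ereal_inf; exists (u k); [exists k|exact: ltW].
Qed.

End Misc.

Section Upper.
Context {R : realType} {X : choiceType} (d : X -> X -> R) (a lam L : R).
Context (Xs : nat -> set X) (Y : nat -> seq X).
Hypothesis dm : is_metric d.
Hypothesis a1 : 1 < a.
Hypothesis lam1 : 1 < lam.
Hypothesis L1 : 1 < L.
Hypothesis XsY : forall n, Xs n = [set` Y n].
Hypothesis Yuniq : forall n, uniq (Y n).
Hypothesis Ysep : forall n, {in Y n &, forall u v, u <> v -> a ^- n <= d u v}.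

Lemma adjG_dist k u v : adjG d a lam k u v -> d u v < 2 * (lam * a ^- k).
Proof.
case=> _ [z []]; rewrite /dball /= => h1 h2.
have := metric_triangle dm z u v; rewrite (metric_sym dm z v); lra.
Qed.

Lemma modG_le (p e : R) n Gam (rho : X -> R) : (forall v, 0 <= rho v) ->
  (forall g, Gam g -> 1 <= \sum_(v <- undup (g.1 :: g.2)) rho v) ->
  \sum_(v <- Y n) powR (rho v) p <= e -> (modG Xs p n Gam <= e%:E)%E.
Proof.
move=> rho0 adm le; apply: ge_ereal_inf; exists (\sum_(v <- Y n) powR (rho v) p)%:E; last first.
  by rewrite lee_fin.
exists rho; last by rewrite XsY -fsbig_seq.
by split => // g /adm; rewrite path_verts_sum.
Qed.

Context (theta : X -> X -> R) (eta : R -> R).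
Hypothesis tm : is_metric theta.
Hypothesis hom : homeo_nonneg eta.
Hypothesis qs : forall x u v : X, x <> v -> theta x u / theta x v <= eta (d x u / d x v).

Lemma qs_le t x u v : 0 <= t -> x <> v -> d x u <= t * d x v ->
  theta x u <= eta t * theta x v.
Proof.
move=> t0 xv h; have dp := metric_gt0 dm xv; have tp := metric_gt0 tm xv.
rewrite -ler_pdivrMr //; apply: (le_trans (qs u xv)).
rewrite (homeo_nonneg_mono hom) ?ler_pdivrMr //.
by rewrite divr_ge0 // ?(metric_ge0 dm) // ltW.
Qed.

Lemma path_sum_ge (e : rel X) (f : X -> R) x q : path e x q -> (forall v, 0 <= f v) ->
  {in x :: q &, forall u v, e u v -> theta u v <= f u} ->
  theta x (last x q) <= \sum_(v <- x :: q) f v.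
Proof.
move=> + f0; elim: q x => [|y q ih] x /=.
  by rewrite big_seq1 (metric_self tm) => _ _; apply: f0.
case/andP=> xy yq h; rewrite big_cons.
apply: (le_trans (metric_triangle tm y _ _)); apply: lerD.
  by apply: h => //; rewrite !inE eqxx ?orbT.
by apply: ih => // u v us vs; apply: h; rewrite inE ?us ?vs orbT.
Qed.

Context (C b p : R).
Hypothesis C0 : 0 < C.
Hypothesis b0 : 0 < b.
Hypothesis ab : assouad_bound theta C b.
Hypothesis bp : b < p.

Section OneBall.
Context (T H t1 e1 : R) (k m : nat) (x z0 y0 : X).
Hypothesis T0 : 0 <= T.
Hypothesis T1 : 2 * (L + 1) <= T * (L - 1).
Hypothesis T2 : 2 * lam <= T.
Hypothesis H1 : 1 <= H.
Hypothesis HT : eta T <= H.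
Hypothesis t10 : 0 < t1.
Hypothesis et1 : eta t1 <= e1.
Hypothesis e10 : 0 <= e1.
Hypothesis He1 : H * e1 <= 1.
Hypothesis k1 : 2 * lam * a ^- k <= 1.
Hypothesis k2 : 4 * lam * a ^- k <= t1 * (L - 1).
Let r := a ^- m.
Hypothesis xz0 : d x z0 < r.
Hypothesis xy0 : L * r <= d x y0.
Hypothesis xy0' : d x y0 < (L + 1) * r.
Let Bs := [seq w <- Y (m + k) | d x w < (L + 1) * r].
(** The [theta]-size of the ball [B(x, r)], read off from one inner point [z0] and one point [y0]
    just outside [B(x, L r)]; quasisymmetry makes every other such pair comparable to it. *)
Let D := theta z0 y0.
Let near w := [seq u <- Bs | d w u < 2 * (lam * a ^- (m + k))].
(** The [theta]-radius of the set of possible neighbours of [w]. An edge leaving [w] inside [Bs] has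
    [theta]-length at most [rw w], so the [rw]-sum along a path bounds its [theta]-length. *)
Let rw w := \big[Num.max/0]_(u <- near w) theta w u.
Let rho w := if w \in Bs then 2 * H * (rw w / D) else 0.

Let a0 : 0 < a. Proof. by have := a1; lra. Qed.
Let r0 : 0 < r. Proof. by rewrite invr_gt0 exprn_gt0. Qed.
Let sE : a ^- (m + k) = r * a ^- k. Proof. by rewrite exprD invfM. Qed.
Let H0 : 0 < H. Proof. by have := H1; lra. Qed.

Let rw_ge0 w : 0 <= rw w.
Proof.
rewrite /rw; elim: (near w) => [|u s ih]; first by rewrite big_nil.
by rewrite big_cons le_max ih orbT.
Qed.

Let rw_ge w u : u \in Bs -> d w u < 2 * (lam * a ^- (m + k)) -> theta w u <= rw w.
Proof.
move=> uB wu; have : u \in near w by rewrite mem_filter wu.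
rewrite /rw; elim: (near w) => // v s ih; rewrite inE big_cons le_max => /orP[/eqP->|/ih ->].
  by rewrite lexx.
by rewrite orbT.
Qed.

Let rw_att w : 0 < rw w -> exists2 u, d w u < 2 * (lam * a ^- (m + k)) & rw w = theta w u.
Proof.
suff : 0 < rw w -> exists2 u, u \in near w & rw w = theta w u.
  by move=> h /h[u]; rewrite mem_filter => /andP[? _] ?; exists u.
rewrite /rw; elim: (near w) => [|v s ih]; first by rewrite big_nil ltxx.
rewrite big_cons maxEle; case: ifP => _; last by exists v; rewrite ?mem_head.
by move=> /ih[u us ->]; exists u; rewrite // inE us orbT.
Qed.

Let mem_Bs w : w \in Bs -> d x w < (L + 1) * r.
Proof. by rewrite mem_filter => /andP[]. Qed.

Let far z y : d x z < r -> L * r <= d x y -> (L - 1) * r <= d z y.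
Proof. have := metric_triangle dm z x y; lra. Qed.

Let farN z y : d x z < r -> L * r <= d x y -> z <> y.
Proof.
move=> h1 h2 e; have := far h1 h2; rewrite e (metric_self dm) leNgt mulr_gt0 //.
by rewrite subr_gt0.
Qed.

Let Dpos : 0 < D. Proof. exact/(metric_gt0 tm)/farN. Qed.

Let qsT z y u v : d x z < r -> L * r <= d x y -> d x u < (L + 1) * r -> d x v < (L + 1) * r ->
  d u v <= T * d z y.
Proof.
move=> h1 h2 h3 h4; have := metric_triangle dm x u v; rewrite (metric_sym dm u x) => h5.
have : T * ((L - 1) * r) <= T * d z y by apply: ler_wpM2l => //; apply: far.
have : 2 * (L + 1) * r <= T * (L - 1) * r by rewrite ler_pM2r.
lra.
Qed.

Let r_lt z : d x z < r -> d x z < (L + 1) * r.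
Proof.
move=> h; apply: (lt_trans h); rewrite -[ltLHS]mul1r ltr_pM2r //; have := L1; lra.
Qed.

Let qsH x' u v : x' <> v -> d x' u <= T * d x' v -> theta x' u <= H * theta x' v.
Proof.
move=> xv h; apply: (le_trans (qs_le T0 xv h)); apply: ler_wpM2r => //.
exact: metric_ge0.
Qed.

Let rho_ge0 w : 0 <= rho w.
Proof.
rewrite /rho; case: ifP => // _.
by rewrite mulr_ge0 // ?divr_ge0 // ?mulr_ge0 // ltW.
Qed.

(** Up to its first exit from [B(x, L r)] the path stays in [Bs], because by [k1] an edge is shorter
    than [r]. Simplicity lets the sum along [q] be compared with the sum over distinct vertices of
    [g]. *)
Lemma exit_path g : GammaKL d a lam Xs L k x m g ->
  exists q, [/\ path (fun u v => `[< Xs (m + k) v /\ adjG d a lam (m + k) u v >]) g.1 q,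
    uniq (g.1 :: q), {subset g.1 :: q <= g.1 :: g.2}, L * r <= d x (last g.1 q) &
    {subset g.1 :: q <= Bs}].
Proof.
case=> -[gX /path_fromP gp] [gx ge].
have Px : d x g.1 < L * r.
  apply: (lt_trans gx); rewrite -[ltLHS]mul1r ltr_pM2r //.
have nP : ~~ (d x (last g.1 g.2) < L * r) by apply/negP => h; apply: ge.
have [q [gq uq sq nq inq]] := simple_exit (P := fun w => d x w < L * r) gp Px nP.
exists q; split => //; first by rewrite leNgt.
move=> w wq; rewrite mem_filter; apply/andP; split.
  case: (inq _ wq) => [h|[u hu /asboolP[_ /adjG_dist]]].
    by apply: (lt_trans h); rewrite ltr_pM2r //; lra.
  rewrite sE => uw; have := metric_triangle dm u x w.
  have : 2 * lam * a ^- k * r <= 1 * r by rewrite ler_pM2r.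
  lra.
have {wq sq}: w \in g.1 :: g.2 by apply: sq.
rewrite inE => /orP[/eqP->|]; first by move: gX; rewrite XsY.
elim: (g.2) (g.1) gp => // v s ih u /= /andP[/asboolP[vX _] vs].
by rewrite inE => /orP[/eqP->|]; [move: vX; rewrite XsY|apply: ih vs].
Qed.

Let rho_adm g : GammaKL d a lam Xs L k x m g -> 1 <= \sum_(v <- undup (g.1 :: g.2)) rho v.
Proof.
move=> gG; have [q [gq uq sq lq qB]] := exit_path gG.
have gx : d x g.1 < r by case: gG => _ [].
apply: (@le_trans _ _ (\sum_(v <- g.1 :: q) rho v)); last first.
  apply: ler_sum_uniq_sub; [exact: uq|exact: undup_uniq| |exact: rho_ge0].
  by move=> v /sq; rewrite mem_undup.
have -> : \sum_(v <- g.1 :: q) rho v = 2 * H / D * \sum_(v <- g.1 :: q) rw v.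
  rewrite mulr_sumr big_seq [RHS]big_seq; apply: eq_bigr => v /qB vB.
  by rewrite /rho vB; ring.
have lB : last g.1 q \in Bs by apply: qB; rewrite mem_last.
have h : theta g.1 (last g.1 q) <= \sum_(v <- g.1 :: q) rw v.
  apply: (path_sum_ge gq) => // u v /qB uB /qB vB /asboolP[_ /adjG_dist uv].
  exact: rw_ge.
(* The factor [2 * H] of [rho] arises here: [D] splits at [g.1] into two distances, each at most [H]
   times the distance between the ends of the path. *)
suff h2 : D <= 2 * H * theta g.1 (last g.1 q).
  rewrite mulrAC ler_pdivlMr // mul1r; apply: (le_trans h2).
  by rewrite ler_pM2l // mulr_gt0.
have h3 := metric_triangle tm g.1 z0 y0; rewrite (metric_sym tm z0 g.1) in h3.
have h4 : theta g.1 z0 <= H * theta g.1 (last g.1 q).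
  by apply: qsH; [apply: farN|apply: qsT => //; apply: r_lt].
have h5 : theta g.1 y0 <= H * theta g.1 (last g.1 q).
  by apply: qsH; [apply: farN|apply: qsT => //; apply: r_lt].
rewrite /D; lra.
Qed.

(** The neighbours of [u] lie within [2 * lam] times the net spacing, hence within [T * d u v], and
    quasisymmetry applies. Thus vertices with large [rw] are [theta]-separated, which allows them to
    be counted. *)
Let rw_sep u v : u \in Bs -> v \in Bs -> u <> v -> rw u <= H * theta u v.
Proof.
move=> uB vB uv; have [r_le0|r_gt0] := leP (rw u) 0.
  by apply: (le_trans r_le0); rewrite mulr_ge0 // ?(metric_ge0 tm) // ltW.
have [w uw ->] := rw_att r_gt0; apply: qsH => //.
have : a ^- (m + k) <= d u v.
  by move: uB vB; rewrite !mem_filter => /andP[_ uY] /andP[_ vY]; apply: Ysep.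
move=> h; have h2 := le_trans (ltW uw : _ <= 2 * (lam * a ^- (m + k))) (_ : _ <= 2 * (lam * d u v)).
apply: (le_trans (h2 _)); last by rewrite mulrA ler_wpM2r // (metric_ge0 dm).
by rewrite ler_pM2l // ler_pM2l //; have := lam1; lra.
Qed.

Let in_ball w : w \in Bs -> theta z0 w <= H * D.
Proof. by move=> /mem_Bs wB; apply: qsH; [apply: farN|apply: qsT => //; apply: r_lt]. Qed.

Let in_ball' w : w \in Bs -> theta y0 w <= H * D.
Proof.
move=> /mem_Bs wB; rewrite /D (metric_sym tm z0); apply: qsH.
  by apply/nesym/farN.
by rewrite (metric_sym dm y0 z0); apply: qsT.
Qed.

(** The points [z0] and [y0] are [(L - 1) * r] apart, so one of them is at least half of that away
    from [w]. Seen against that distance an edge at [w] has ratio at most [t1], which is where large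
    [k] enters. *)
Let rw_small w : w \in Bs -> rw w <= H * e1 * D.
Proof.
move=> wB; have [r_le0|r_gt0] := leP (rw w) 0.
  by apply: (le_trans r_le0); rewrite !mulr_ge0 // ltW.
have [u wu ->] := rw_att r_gt0.
have key f : (L - 1) * r <= 2 * d w f -> theta f w <= H * D -> theta w u <= H * e1 * D.
  move=> wf fw; have wf' : w <> f.
    move=> e; move: wf; rewrite e (metric_self dm) mulr0 leNgt mulr_gt0 //.
    by rewrite subr_gt0.
  have : theta w u <= eta t1 * theta w f.
    apply: (qs_le (ltW t10)) => //; apply: (le_trans (ltW wu)); rewrite sE.
    have : 4 * lam * a ^- k * r <= t1 * (L - 1) * r by rewrite ler_pM2r.
    have : t1 * ((L - 1) * r) <= t1 * (2 * d w f) by rewrite ler_pM2l.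
    lra.
  move/le_trans; apply.
  rewrite [H * e1]mulrC -mulrA (metric_sym tm w).
  by apply: ler_pM => //; rewrite ?(metric_ge0 tm) // (homeo_nonneg_ge0 hom) // ltW.
have [h|h] := leP ((L - 1) * r) (2 * d w z0); first exact: (key z0 h (in_ball wB)).
apply: (key y0 _ (in_ball' wB)).
have := far xz0 xy0; have := metric_triangle dm w z0 y0; rewrite (metric_sym dm z0 w); lra.
Qed.

(** Split the exponent as [(p - p') + p']. The first part is uniformly small by [rw_small]; the
    second, with [p' > b], is summed by layers of [- ln (rw w / D)]. *)
Let rho_sum (p' : R) : b < p' -> p' < p ->
  \sum_(w <- Y (m + k)) powR (rho w) p <=
  powR (2 * H) p * powR (H * e1) (p - p') *
    (C * powR (2 * H * (H + 1)) b * expR b / (1 - expR (b - p'))).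
Proof.
move=> bp' p'p; have p0 : 0 < p by apply: lt_trans b0 bp.
pose h w := - ln (rw w / D).
pose B' := [seq w <- Bs | 0 < rw w].
have B'P w : w \in B' -> w \in Bs /\ 0 < rw w by rewrite mem_filter => /andP[].
have ratio w : w \in B' -> 0 < rw w / D by move=> /B'P[_ h0]; rewrite divr_gt0.
have -> : \sum_(w <- Y (m + k)) powR (rho w) p =
    powR (2 * H) p * \sum_(w <- B') powR (rw w / D) p.
  rewrite mulr_sumr /B' big_filter /Bs big_filter_cond [RHS]big_mkcond /=.
  rewrite big_seq [RHS]big_seq; apply: eq_bigr => w wY.
  rewrite /rho mem_filter wY andbT; case: ifP => hw /=; last by rewrite powR0 ?gt_eqF.
  case: ltP => r_le; last first.
    have -> : rw w = 0 by apply/le_anti; rewrite r_le rw_ge0.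
    by rewrite mul0r mulr0 powR0 ?gt_eqF.
  have q0 : 0 <= rw w / D by rewrite divr_ge0 ?rw_ge0 // ltW.
  have h0 : 0 <= 2 * H by rewrite mulr_ge0 // ltW.
  by rewrite powRM.
rewrite -mulrA ler_wpM2l ?powR_ge0 //.
apply: (@le_trans _ _ (powR (H * e1) (p - p') * \sum_(w <- B') expR (- p' * h w))).
  rewrite mulr_sumr big_seq [leRHS]big_seq; apply: ler_sum => w wB.
  have q0 := ratio _ wB; have [wB' _] := B'P _ wB.
  have -> : expR (- p' * h w) = powR (rw w / D) p' by rewrite /powR gt_eqF // /h mulrNN.
  have -> : p = (p - p') + p' by rewrite subrK.
  rewrite powRD; last by rewrite (gt_eqF q0) implybT.
  rewrite addrK ler_wpM2r ?powR_ge0 //; apply: ge0_ler_powR.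
  - by rewrite subr_ge0 ltW.
  - by rewrite nnegrE ltW.
  - by rewrite nnegrE mulr_ge0 // ltW.
  - by rewrite ler_pdivrMr // rw_small.
rewrite ler_wpM2l ?powR_ge0 //; apply: layer_sum.
- by rewrite mulr_ge0 ?powR_ge0 // ltW.
- by have := b0; lra.
- by [].
- move=> w wB; rewrite /h oppr_ge0 ln_le0 // ler_pdivrMr // mul1r.
  have [wB' _] := B'P _ wB; apply: (le_trans (rw_small wB')).
  by rewrite -[leRHS]mul1r ler_wpM2r // ltW.
move=> i; rewrite -size_filter; pose E : R := expR (- i.+1%:R).
have E0 : 0 < E by apply: expR_gt0.
have E1 : E < 1 by rewrite /E -[ltRHS]expR0 ltr_expR oppr_lt0 ltr0n.
(* In this layer [rw w > D * E], so [rw_sep] separates its points by [D * E / H = 2 * t]; they all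
   lie in the [theta]-ball of radius [(H + 1) * D] about [z0]. *)
pose t := D * E / (2 * H).
have H20 : 0 < 2 * H by rewrite mulr_gt0.
have tE : 2 * t = D * E / H by rewrite /t; field; rewrite gt_eqF.
have t0 : 0 < t by rewrite /t divr_gt0 // mulr_gt0.
have DE : D * E < D by rewrite gtr_pMr.
have tD : t < (H + 1) * D.
  rewrite /t ltr_pdivrMr //; apply: (lt_trans DE); rewrite mulrAC -[ltLHS]mul1r ltr_pM2r //.
  have : 1 * 1 <= H * H by apply: ler_pM.
  by have := H1; lra.
have := @separated_size_le R X theta tm C b z0 ((H + 1) * D) t
  [seq w <- B' | h w < i.+1%:R] ab _ _ _ t0 tD.
have -> : (H + 1) * D / t = 2 * H * (H + 1) * expR (i.+1%:R).
  rewrite /t /E expRN; field.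
  by rewrite !gt_eqF // expR_gt0.
rewrite powRM ?expR_ge0 //; last by rewrite !mulr_ge0 // ?addr_ge0 // ltW.
rewrite -expRM [in X in expR X]mulrC mulrA; apply.
- by rewrite !filter_uniq // /B' /Bs !filter_uniq.
- move=> u v; rewrite !mem_filter => /andP[hu /andP[ru uB]] /andP[hv /andP[rv vB]] uv.
  have uB' : u \in Bs by rewrite /Bs mem_filter.
  have vB' : v \in Bs by rewrite /Bs mem_filter.
  rewrite tE ler_pdivrMr // [leRHS]mulrC; apply: le_trans (rw_sep uB' vB' uv).
  rewrite mulrC -ler_pdivlMr // ltW // /E -[ltRHS]lnK ?posrE ?divr_gt0 //.
  by rewrite ltr_expR; move: hu; rewrite /h; lra.
- move=> w; rewrite mem_filter => /andP[_ /B'P[wB _]].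
  by apply: (le_lt_trans (in_ball wB)); rewrite ltr_pM2r //; lra.
Qed.

Lemma modG_ball (p' : R) : b < p' -> p' < p ->
  (modG Xs p (m + k) (GammaKL d a lam Xs L k x m) <=
   (powR (2 * H) p * powR (H * e1) (p - p') *
    (C * powR (2 * H * (H + 1)) b * expR b / (1 - expR (b - p'))))%:E)%E.
Proof. by move=> bp' p'p; apply: modG_le rho_adm (rho_sum bp' p'p). Qed.

End OneBall.

Lemma modG_small (e : R) : 0 < e -> exists K, forall k m x, (K <= k)%N ->
  (modG Xs p (m + k) (GammaKL d a lam Xs L k x m) <= e%:E)%E.
Proof.
move=> e0; have p0 : 0 < p by apply: lt_trans b0 bp.
pose p' := (b + p) / 2; have bp' : b < p' by rewrite /p'; have := bp; lra.
have p'p : p' < p by rewrite /p'; have := bp; lra.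
have L10 : 0 < L - 1 by have := L1; lra.
have l0 : 0 < 2 * lam by have := lam1; lra.
pose T := 2 * (L + 1) / (L - 1) + 2 * lam.
have T2' : 0 <= 2 * (L + 1) / (L - 1) by rewrite divr_ge0 //; lra.
have T0 : 0 <= T by rewrite /T; lra.
have T1 : 2 * (L + 1) <= T * (L - 1).
  by rewrite /T [leRHS]mulrDl divfK ?gt_eqF // lerDl mulr_ge0 // ltW.
have T2 : 2 * lam <= T by rewrite /T; lra.
pose H := Num.max 1 (eta T).
have H1 : 1 <= H by rewrite le_max lexx.
have HT : eta T <= H by rewrite le_max lexx orbT.
have H0 : 0 < H by apply: lt_le_trans H1.
pose M := powR (2 * H) p * (C * powR (2 * H * (H + 1)) b * expR b / (1 - expR (b - p'))).
have M0 : 0 < M.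
  have g0 : 0 < 1 - expR (b - p').
    by rewrite subr_gt0 -[ltRHS]expR0 ltr_expR subr_lt0.
  have h2 : 0 < 2 * H by rewrite mulr_gt0.
  have h3 : 0 < 2 * H * (H + 1) by rewrite mulr_gt0 // addr_gt0.
  by rewrite mulr_gt0 ?powR_gt0 // divr_gt0 // mulr_gt0 ?expR_gt0 // mulr_gt0 ?powR_gt0.
(* [M] is independent of [e1], so [H * e1] can be taken below the value [y] at which
   [M * powR y (p - p') = e]. *)
pose y := powR (e / M) ((p - p')^-1).
have y0 : 0 < y by rewrite powR_gt0 // divr_gt0.
pose e1 := Num.min 1 y / H.
have mn : 0 < Num.min 1 y by rewrite lt_min ltr01.
have e10 : 0 < e1 by rewrite divr_gt0.
have He1 : H * e1 = Num.min 1 y by rewrite /e1 mulrCA mulfV ?mulr1 // gt_eqF.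
have [t1 t10 et1] := homeo_nonneg_small hom e10.
have s1 : 0 < (2 * lam)^-1 by rewrite invr_gt0.
have s2 : 0 < t1 * (L - 1) / (4 * lam) by rewrite divr_gt0 ?mulr_gt0 //; have := lam1; lra.
have [K1 hK1] := exprV_small a1 s1; have [K2 hK2] := exprV_small a1 s2.
exists (maxn K1 K2) => k m x; rewrite geq_max => /andP[/hK1 k1 /hK2 k2].
have {}k1 : 2 * lam * a ^- k <= 1 by rewrite mulrC -ler_pdivlMr // mul1r.
have {}k2 : 4 * lam * a ^- k <= t1 * (L - 1).
  by rewrite mulrC -ler_pdivlMr //; have := lam1; lra.
(* A path of the family supplies the reference points [z0] and [y0]; an empty family has the zero
   weight. *)
have [[g0 gG]|nG] := pselect (exists g, GammaKL d a lam Xs L k x m g); last first.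
  apply: (modG_le (rho := fun=> 0)) => // [g gG|]; first by case: nG; exists g.
  by rewrite big1 ?ltW // => v _; rewrite powR0 // gt_eqF.
have [q [_ _ _ lq qB]] := exit_path k1 gG.
have xy' : d x (last g0.1 q) < (L + 1) * a ^- m.
  by have := qB _ (mem_last _ _); rewrite mem_filter => /andP[].
have xz : d x g0.1 < a ^- m by case: gG => _ [].
have e10' := ltW e10.
have He1' : H * e1 <= 1 by rewrite He1 ge_min lexx.
apply: (le_trans (modG_ball T0 T1 T2 H1 HT t10 et1 e10' He1' k1 k2 xz lq xy' bp' p'p)).
rewrite lee_fin.
rewrite mulrAC -/M -ler_pdivlMl // [leRHS]mulrC He1.
have -> : e / M = powR y (p - p').
  by rewrite /y -powRrM mulVf ?powRr1 ?divr_ge0 ?ltW // gt_eqF // subr_gt0.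
apply: ge0_ler_powR; last by rewrite ge_min lexx orbT.
- by rewrite subr_ge0 ltW.
- by rewrite nnegrE ltW.
- by rewrite nnegrE ltW.
Qed.

End Upper.

(** * Critical exponent below the dimension of every metric in the gauge *)

Section UpperBound.
Context {R : realType} {X : choiceType} (d : X -> X -> R) (a lam L : R).
Context (Xs : nat -> set X) (Y : nat -> seq X).
Hypothesis dm : is_metric d.
Hypothesis a1 : 1 < a.
Hypothesis lam1 : 1 < lam.
Hypothesis L1 : 1 < L.
Hypothesis XsY : forall n, Xs n = [set` Y n].
Hypothesis Yuniq : forall n, uniq (Y n).
Hypothesis Ysep : forall n, {in Y n &, forall u v, u <> v -> a ^- n <= d u v}.
Hypothesis Y0 : exists x, x \in Y 0%N.

(** A net point of level 0 is exhibited because the supremum of an empty set would be [-oo]. *)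
Lemma Mpk_ge0 (p : R) k : (0 <= Mpk d a lam Xs p L k)%E.
Proof.
have [x xY] := Y0; apply: le_ereal_sup_tmp.
exists (modG Xs p (0 + k) (GammaKL d a lam Xs L k x 0)).
  by exists (x, 0%N); rewrite //= XsY.
apply: le_ereal_inf_tmp => _ [rho _ <-]; rewrite lee_fin XsY -fsbig_seq //.
by apply: sumr_ge0 => v _; apply: powR_ge0.
Qed.

Lemma CE_le_dimA (theta : X -> X -> R) : gauge d theta ->
  (CE d a lam Xs L <= dimA theta)%E.
Proof.
case=> tm [eta hom qs]; apply: le_ereal_inf_tmp => _ [b [b0 [C C0 ab]] <-].
apply/lee_addgt0Pr => e e0; rewrite -EFinD; apply: ge_ereal_inf.
exists (b + e)%:E => //; exists (b + e) => //.
have bp : b < b + e by rewrite ltrDl.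
split; first exact: addr_gt0.
apply/limn_einf_eq0 => [k|r N r0]; first exact: Mpk_ge0.
have r2 : 0 < r / 2 by lra.
have [K hK] := modG_small (Xs := Xs) (Y := Y) dm a1 lam1 L1 XsY Yuniq Ysep tm hom qs C0 b0 ab bp r2.
exists (maxn N K); first exact: leq_maxl.
apply: (@le_lt_trans _ _ (r / 2)%:E); last by rewrite lte_fin; lra.
by apply: ge_ereal_sup => _ [[x m] _ <-]; apply: hK; exact: leq_maxr.
Qed.

End UpperBound.

(** * Level weights from a small modulus *)

Section Weights.
Context {R : realType} {X : choiceType} (d : X -> X -> R) (a : R) (Y : nat -> seq X).
Hypothesis dm : is_metric d.
Hypothesis a1 : 1 < a.
Hypothesis Ycov : forall n x, exists2 u, u \in Y n & d x u < a ^- n.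
Context (k k' j : nat) (p Lr M1 M2 delta e eta : R) (rho : nat -> X -> X -> R).
Hypothesis kE : k = (k' + j)%N.
Hypothesis p0 : 0 < p.
Hypothesis Lr1 : 1 <= Lr.
Hypothesis ak' : 4 <= a ^+ k'.
Hypothesis M1P : forall n x, \sum_(u <- Y n) expR (- 1 * (d x u * a ^+ n)) <= M1.
Hypothesis M2P : forall n x, \sum_(u <- Y n) expR (- (2 * a ^+ j)^-1 * (d x u * a ^+ n)) <= M2.
(** Inverse scales: the centres [v] of level [n] live at [S n], the weights [rho n v] at the finer
    [T n], and [j] further net steps lead from [T n] to [S n.+1]. *)
Let S n := a ^+ (k * n).
Let T n := a ^+ (k * n + k').
Let V n := Y (k * n).
Let U n := Y (k * n + k').
Hypothesis rho0 : forall n v u, 0 <= rho n v u.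
Hypothesis rho_far : forall n v u, v \in V n -> Lr < d v u * S n -> rho n v u = 0.
Hypothesis rho_near : forall n v u, v \in V n -> u \in U n -> d v u * S n <= Lr ->
  delta <= rho n v u.
Hypothesis rho_sum : forall n v, v \in V n -> \sum_(u <- U n) powR (rho n v u) p <= e.
Hypothesis delta0 : 0 < delta.
Hypothesis e0 : 0 < e.
Hypothesis eM1 : e * expR (1 + 2 * Lr) * M1 <= eta.
Hypothesis eM2 : e * expR (1 + 2 * Lr) * M2 <= 2^-1.

Let a0 : 0 < a. Proof. by have := a1; lra. Qed.
Let S0 n : 0 < S n. Proof. exact: exprn_gt0. Qed.
Let T0 n : 0 < T n. Proof. exact: exprn_gt0. Qed.
Let ST n : 4 * S n <= T n.
Proof. by rewrite /T exprD mulrC ler_pM2l // exprn_gt0. Qed.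
Let TE n : T n * a ^+ j = S n.+1.
Proof. by rewrite /T /S -exprD -addnA -kE mulnS addnC. Qed.
Let TS n : T n <= S n.+1.
Proof. by rewrite -TE ler_peMr ?(ltW (T0 n)) // exprn_ege1 // ltW. Qed.
Let Smono m n : (m <= n)%N -> S m <= S n.
Proof. by move=> mn; apply: ler_weXn2l; [exact: ltW|rewrite leq_mul2l mn orbT]. Qed.
Let d0 x y : 0 <= d x y. Proof. exact: metric_ge0. Qed.

(* The last factor is at least 1 when [d x u <= 1 / T n], whence [level_weight_step]; its logarithm
   is Lipschitz in [x], whence [level_mass_harnack]. *)
Fixpoint level_mass n x : R :=
  if n is n'.+1 then \sum_(v <- Y (k * n')) \sum_(u <- Y (k * n' + k'))
    level_mass n' v * powR (rho n' v u) p * expR (1 - d x u * a ^+ (k * n' + k'))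
  else 1.

Lemma level_mass_ge0 n x : 0 <= level_mass n x.
Proof.
elim: n x => //= n ih x; apply: sumr_ge0 => v _; apply: sumr_ge0 => u _.
by rewrite mulr_ge0 ?expR_ge0 // mulr_ge0 ?powR_ge0.
Qed.

Lemma level_mass_harnack n x y : level_mass n x <= expR (d x y * S n) * level_mass n y.
Proof.
case: n => [|n] /=; first by rewrite mulr1 -[leLHS]expR0 ler_expR mulr_ge0 // ltW.
rewrite mulr_sumr; apply: ler_sum => v _; rewrite mulr_sumr; apply: ler_sum => u _.
rewrite mulrCA; apply: ler_wpM2l; first by rewrite mulr_ge0 ?powR_ge0 ?level_mass_ge0.
rewrite -expRD ler_expR -/(T n).
have h1 : d x y * T n <= d x y * S n.+1 by apply: ler_wpM2l.
have h2 : d y u * T n <= (d x y + d x u) * T n.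
  by rewrite ler_pM2r // (metric_sym dm x y); apply: metric_triangle.
lra.
Qed.

Lemma level_mass_term n x v u : v \in V n -> u \in U n ->
  level_mass n v * powR (rho n v u) p * expR (1 - d x u * T n) <= level_mass n.+1 x.
Proof.
move=> vV uU /=.
have t0 v' u' : 0 <= level_mass n v' * powR (rho n v' u') p * expR (1 - d x u' * T n).
  by rewrite mulr_ge0 ?expR_ge0 // mulr_ge0 ?powR_ge0 // level_mass_ge0.
rewrite (big_rem v) //= (big_rem u) //= -addrA lerDl addr_ge0 //.
  by apply: sumr_ge0 => u' _; apply: t0.
by apply: sumr_ge0 => v' _; apply: sumr_ge0 => u' _; apply: t0.
Qed.

Let rho_cases n v u : v \in V n -> rho n v u = 0 \/ d v u * S n <= Lr.
Proof. by move=> vV; case: (leP (d v u * S n) Lr) => [|/(rho_far vV)]; [right|left]. Qed.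

(** Only [v] and [u] at distance at most [Lr / S n] contribute. Since [T n >= 4 * S n], the kernel
    at [u] beats the Harnack factor from [v] to [x] and leaves [expR (- (d x v * S n))], summed over
    [v] by [M1]. *)
Lemma level_mass_decay n x : level_mass n.+1 x <= eta * level_mass n x.
Proof.
have key v : v \in V n ->
    \sum_(u <- U n) level_mass n v * powR (rho n v u) p * expR (1 - d x u * T n) <=
    expR (1 + 2 * Lr) * level_mass n x * e * expR (- 1 * (d x v * S n)).
  move=> vV; have h := rho_sum vV.
  have : expR (1 + 2 * Lr) * level_mass n x * expR (- 1 * (d x v * S n)) *
      (\sum_(u <- U n) powR (rho n v u) p) <=
      expR (1 + 2 * Lr) * level_mass n x * expR (- 1 * (d x v * S n)) * e.
    by apply: ler_wpM2l h; rewrite !mulr_ge0 ?expR_ge0 ?level_mass_ge0.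
  rewrite [leRHS]mulrAC; apply: le_trans; rewrite mulr_sumr; apply: ler_sum => u _.
  case: (rho_cases u vV) => [->|near]; first by rewrite powR0 ?gt_eqF // !(mulr0, mul0r).
  have hx : level_mass n v <= expR (d x v * S n) * level_mass n x.
    by rewrite (metric_sym dm x v); apply: level_mass_harnack.
  rewrite mulrAC ler_wpM2r ?powR_ge0 //.
  apply: (le_trans (ler_wpM2r (expR_ge0 _) hx)).
  rewrite mulrAC [leRHS]mulrAC -!expRD ler_wpM2r ?level_mass_ge0 // ler_expR.
  have h1 : d x v * S n <= (d x u + d v u) * S n.
    by rewrite ler_pM2r // (metric_sym dm v u); apply: metric_triangle.
  have h2 : d x u * (4 * S n) <= d x u * T n by apply: ler_wpM2l.
  have h3 : 0 <= d x u * S n by rewrite mulr_ge0 // ltW.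
  lra.
rewrite /= big_seq; apply: (le_trans (ler_sum _ key)); rewrite -big_seq -mulr_sumr.
have h := M1P (k * n) x.
have : expR (1 + 2 * Lr) * level_mass n x * e * (\sum_(u <- V n) expR (- 1 * (d x u * S n))) <=
   expR (1 + 2 * Lr) * level_mass n x * e * M1.
  by apply: ler_wpM2l h; rewrite !mulr_ge0 ?expR_ge0 ?level_mass_ge0 // ltW.
move/le_trans; apply.
have := ler_wpM2r (level_mass_ge0 n x) eM1.
by have -> : e * expR (1 + 2 * Lr) * M1 * level_mass n x =
  expR (1 + 2 * Lr) * level_mass n x * e * M1 by ring.
Qed.

(** One term suffices: [u] is a net point near [x] and [v] one near [u], so [rho n v u >= delta],
    and [d x v * S n < 2] accounts for [expR (- 2)]. *)
Lemma level_mass_growth n x : powR delta p * expR (- 2) * level_mass n x <= level_mass n.+1 x.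
Proof.
have [u uU xu] := Ycov (k * n + k') x; have [v vV uv] := Ycov (k * n) u.
have {}xu : d x u * T n < 1 by rewrite -ltr_pdivlMr // mul1r.
have {}uv : d u v * S n < 1 by rewrite -ltr_pdivlMr // mul1r.
apply: le_trans (level_mass_term x vV uU).
have h1 : d x v * S n <= (d x u + d u v) * S n.
  by rewrite ler_pM2r //; apply: metric_triangle.
have h2 : d x u * (4 * S n) <= d x u * T n by apply: ler_wpM2l.
have h3 : 0 <= d x u * S n by rewrite mulr_ge0 // ltW.
have hr : delta <= rho n v u.
  apply: rho_near => //; rewrite (metric_sym dm); apply: (le_trans (ltW uv)); exact: Lr1.
have hp : powR delta p <= powR (rho n v u) p.
  by apply: ge0_ler_powR => //; rewrite ?nnegrE // ltW.
have hm : expR (- 2) * level_mass n x <= level_mass n v.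
  apply: (le_trans (ler_wpM2l (expR_ge0 _) (level_mass_harnack n x v))).
  rewrite mulrA -expRD -[leRHS]mul1r ler_wpM2r ?level_mass_ge0 // -[leRHS]expR0 ler_expR; lra.
rewrite -mulrA [leRHS]mulrAC mulrC -[leLHS]mulr1 -[leLHS]mulrA [powR _ _ * 1]mulrC mulrA.
apply: ler_pM => //; rewrite ?mulr_ge0 ?expR_ge0 ?level_mass_ge0 ?powR_ge0 //.
rewrite mulr1; apply: (le_trans hm); rewrite -[leLHS]mulr1.
apply: ler_wpM2l; first exact: level_mass_ge0.
rewrite -[leLHS]expR0 ler_expR; lra.
Qed.

Lemma level_mass_gt0 n x : 0 < level_mass n x.
Proof.
elim: n => // n ih; apply: lt_le_trans (level_mass_growth n x).
by rewrite !mulr_gt0 ?powR_gt0 ?expR_gt0.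
Qed.

(** Sum over [z] first. Moving the cutoff from [z] to [v] costs [expR (2 * Lr)] and half of the
    decay of the kernel; the other half sums to [M2], whose rate contains [a ^+ j] because [z] runs
    over the net of scale [S n.+1]. *)
Lemma level_mass_mass m n x0 : (m <= n)%N ->
  \sum_(z <- V n.+1) expR (- 2 * (d x0 z * S m)) * level_mass n.+1 z <=
  2^-1 * \sum_(v <- V n) expR (- 2 * (d x0 v * S m)) * level_mass n v.
Proof.
move=> mn; pose f z := expR (- 2 * (d x0 z * S m)).
have -> : \sum_(z <- V n.+1) f z * level_mass n.+1 z =
  \sum_(v <- V n) \sum_(u <- U n) level_mass n v * powR (rho n v u) p *
    \sum_(z <- V n.+1) f z * expR (1 - d z u * T n).
  under eq_bigr do rewrite /= mulr_sumr; rewrite exchange_big /=; apply: eq_bigr => v _.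
  under eq_bigr do rewrite mulr_sumr; rewrite exchange_big /=; apply: eq_bigr => u _.
  by rewrite mulr_sumr; apply: eq_bigr => z _; rewrite mulrCA.
rewrite mulr_sumr big_seq [leRHS]big_seq; apply: ler_sum => v vV.
apply: (@le_trans _ _ (\sum_(u <- U n) level_mass n v * powR (rho n v u) p *
    (f v * (expR (1 + 2 * Lr) * M2)))).
  apply: ler_sum => u _; case: (rho_cases u vV) => [->|near].
    by rewrite powR0 ?gt_eqF // !(mulr0, mul0r).
  apply: ler_wpM2l; first by rewrite mulr_ge0 ?powR_ge0 ?level_mass_ge0.
  have h := M2P (k * n.+1) u; rewrite mulrA.
  have fe : 0 <= f v * expR (1 + 2 * Lr) by rewrite mulr_ge0 ?expR_ge0.
  apply: le_trans (ler_wpM2l fe h); rewrite mulr_sumr; apply: ler_sum => z _.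
  rewrite -!expRD ler_expR.
  have -> : - (2 * a ^+ j)^-1 * (d u z * a ^+ (k * n.+1)) = - (d z u * T n / 2).
    rewrite -/(S n.+1) -TE (metric_sym dm u z); field.
    by rewrite expf_neq0 // gt_eqF.
  have h1 : d x0 v * S m <= (d x0 z + (d z u + d v u)) * S m.
    rewrite ler_pM2r //; apply: (le_trans (metric_triangle dm z _ _)).
    by rewrite lerD2l (metric_sym dm v u); apply: metric_triangle.
  have h2 : d z u * (4 * S n) <= d z u * T n by apply: ler_wpM2l.
  have h3 : d v u * S m <= d v u * S n by rewrite ler_wpM2l // Smono.
  have h4 : d z u * S m <= d z u * S n by rewrite ler_wpM2l // Smono.
  lra.
rewrite -mulr_suml -mulr_sumr.
have h := rho_sum vV.
have fm : 0 <= f v * level_mass n v by rewrite mulr_ge0 ?expR_ge0 ?level_mass_ge0.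
apply: le_trans (ler_wpM2r fm eM2).
have -> : level_mass n v * (\sum_(u <- U n) powR (rho n v u) p) * (f v * (expR (1 + 2 * Lr) * M2)) =
  (\sum_(u <- U n) powR (rho n v u) p) * (expR (1 + 2 * Lr) * M2 * (f v * level_mass n v)) by ring.
have -> : e * expR (1 + 2 * Lr) * M2 * (f v * level_mass n v) =
  e * (expR (1 + 2 * Lr) * M2 * (f v * level_mass n v)) by ring.
apply: ler_wpM2r => //; rewrite mulr_ge0 // mulr_ge0 ?expR_ge0 //.
apply: le_trans (M2P 0 x0); apply: sumr_ge0 => u _; exact: expR_ge0.
Qed.

(** The masses of successive levels halve, so their sum is at most twice that of level [m]; there,
    Harnack uses up one of the two units of decay of the cutoff. *)
Lemma level_mass_total m N x0 :
  \sum_(n < N) \sum_(z <- V (m + n)) expR (- 2 * (d x0 z * S m)) * level_mass (m + n) z <=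
  2 * M1 * level_mass m x0.
Proof.
have base : \sum_(v <- V m) expR (- 2 * (d x0 v * S m)) * level_mass m v <= M1 * level_mass m x0.
  have h := M1P (k * m) x0.
  apply: le_trans (ler_wpM2r (level_mass_ge0 m x0) h); rewrite mulr_suml; apply: ler_sum => v _.
  apply: (le_trans (ler_wpM2l (expR_ge0 _) (level_mass_harnack m v x0))).
  rewrite mulrA -expRD ler_wpM2r ?level_mass_ge0 // ler_expR (metric_sym dm v x0) -/(S m); lra.
have step n : \sum_(v <- V (m + n)) expR (- 2 * (d x0 v * S m)) * level_mass (m + n) v <=
    2^-1 ^+ n * (M1 * level_mass m x0).
  elim: n => [|n ih]; first by rewrite addn0 mul1r.
  rewrite addnS; apply: (le_trans (level_mass_mass _ (leq_addr _ _))).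
  by rewrite exprS -mulrA ler_pM2l.
apply: (@le_trans _ _ (\sum_(n < N) 2^-1 ^+ n * (M1 * level_mass m x0))).
  by apply: ler_sum => n _; apply: step.
rewrite -mulr_suml -[leRHS]mulrA; apply: ler_wpM2r.
  by apply: le_trans base; apply: sumr_ge0 => v _; rewrite mulr_ge0 ?expR_ge0 ?level_mass_ge0.
have q0 : 0 <= 2^-1 :> R by lra.
have q1 : 2^-1 < 1 :> R by lra.
apply: (le_trans (geometric_sum_le N q0 q1)).
by have -> : (1 - 2^-1)^-1 = 2 :> R by field.
Qed.

Definition level_weight n x := powR (level_mass n x) p^-1.

Let pV0 : 0 < p^-1. Proof. by rewrite invr_gt0. Qed.

Lemma level_weight_gt0 n x : 0 < level_weight n x.
Proof. by rewrite powR_gt0 // level_mass_gt0. Qed.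

Lemma powR_level_weight n x : powR (level_weight n x) p = level_mass n x.
Proof. by rewrite /level_weight -powRrM mulVf ?gt_eqF // powRr1 // level_mass_ge0. Qed.

Let powRV_le x y : 0 <= x -> x <= y -> powR x p^-1 <= powR y p^-1.
Proof.
move=> x0 xy; apply: ge0_ler_powR; rewrite ?nnegrE //; first exact: ltW.
exact: le_trans xy.
Qed.

Lemma level_weight_harnack n x y :
  level_weight n x <= expR (p^-1 * (d x y * S n)) * level_weight n y.
Proof.
apply: (le_trans (powRV_le (level_mass_ge0 n x) (level_mass_harnack n x y))).
by rewrite powRM ?expR_ge0 ?level_mass_ge0 // -expRM [in X in expR X]mulrC.
Qed.

Lemma level_weight_decay n x : 0 <= eta -> level_weight n.+1 x <= powR eta p^-1 * level_weight n x.
Proof.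
move=> eta0; apply: (le_trans (powRV_le (level_mass_ge0 _ _) (level_mass_decay n x))).
by rewrite powRM ?level_mass_ge0.
Qed.

Lemma level_weight_growth n x :
  powR (powR delta p * expR (- 2)) p^-1 * level_weight n x <= level_weight n.+1 x.
Proof.
have h : 0 <= powR delta p * expR (- 2) by rewrite mulr_ge0 ?powR_ge0 ?expR_ge0.
rewrite -powRM ?level_mass_ge0 //; apply: powRV_le (level_mass_growth n x).
by rewrite mulr_ge0 ?level_mass_ge0.
Qed.

Lemma level_weight_step n z v u : v \in V n -> u \in U n -> d z u * T n <= 1 ->
  level_weight n v * rho n v u <= level_weight n.+1 z.
Proof.
move=> vV uU zu.
have -> : rho n v u = powR (powR (rho n v u) p) p^-1.
  by rewrite -powRrM mulfV ?gt_eqF // powRr1.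
rewrite -powRM ?level_mass_ge0 ?powR_ge0 //; apply: powRV_le.
  by rewrite mulr_ge0 ?level_mass_ge0 ?powR_ge0.
apply: le_trans (level_mass_term z vV uU); rewrite -[leLHS]mulr1 ler_wpM2l //.
  by rewrite mulr_ge0 ?level_mass_ge0 ?powR_ge0.
rewrite -[leLHS]expR0 ler_expR; lra.
Qed.

End Weights.

(** * Eliminating fine levels from chains *)

Section Chains.
Context {R : realType} {X : choiceType} (d : X -> X -> R) (a : R).
Context (k : nat) (pi : nat -> X -> R).
Local Notation r := (fun n => a ^- (k * n)).

(* Chains whose steps have level at most [N], up to gaps of size [g * r N]; a step [(n, z, x')]
   jumps from [z] to [x'] at cost [pi n z], and steps of level 0 may be arbitrarily long. *)
Fixpoint gap_chain (g c : R) (N : nat) (x : X) (s : seq (nat * X * X)) (y : X) : Prop :=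
  if s is (n, z, x') :: s' then
    [/\ (n <= N)%N, d x z <= g * r N, n = 0%N \/ d z x' <= c * r n & gap_chain g c N x' s' y]
  else d x y <= g * r N.

Definition chain_cost (s : seq (nat * X * X)) := \sum_(e <- s) pi e.1.1 e.1.2.

End Chains.

Section Eliminate.
Context {R : realType} {X : choiceType} (d : X -> X -> R) (a lam L : R).
Context (Xs : nat -> set X) (Y : nat -> seq X).
Hypothesis dm : is_metric d.
Hypothesis a1 : 1 < a.
Hypothesis lam1 : 1 < lam.
Hypothesis L1 : 1 < L.
Hypothesis XsY : forall n, Xs n = [set` Y n].
Hypothesis Ycov : forall n x, exists2 u, u \in Y n & d x u < a ^- n.
Context (k k' j : nat) (pi : nat -> X -> R) (rho : nat -> X -> X -> R).
Hypothesis kE : k = (k' + j)%N.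
Hypothesis aj : 2 * L + 6 <= (lam - 1) * a ^+ j.
Hypothesis ak' : 2 * lam <= a ^+ k'.
Hypothesis rho0 : forall n v u, 0 <= rho n v u.
Hypothesis pi0 : forall n x, 0 <= pi n x.
Hypothesis pi_step : forall n z v u, v \in Y (k * n) -> u \in Y (k * n + k') ->
  d z u <= a ^- (k * n + k') -> pi n v * rho n v u <= pi n.+1 z.
Hypothesis rho_adm : forall n v g, v \in Y (k * n) -> GammaKL d a lam Xs L k' v (k * n) g ->
  {in g.1 :: g.2, forall w, d v w <= (L + 1) * a ^- (k * n)} ->
  1 <= \sum_(w <- g.1 :: g.2) rho n v w.

Let a0 : 0 < a. Proof. by have := a1; lra. Qed.
Local Notation gap_chain := (gap_chain d a k (L + 4) (L + 2)).
Local Notation cost := (chain_cost pi).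

Section OneLevel.
Variables (N : nat) (y : X).
Let r := a ^- (k * N).
Let s := a ^- (k * N + k').
Let r' := a ^- (k * N.+1).
Let rpos : 0 < r. Proof. by rewrite invr_gt0 exprn_gt0. Qed.
Let spos : 0 < s. Proof. by rewrite invr_gt0 exprn_gt0. Qed.
Let r'pos : 0 < r'. Proof. by rewrite invr_gt0 exprn_gt0. Qed.

Let sr : 2 * (lam * s) <= r.
Proof.
have -> : r = a ^+ k' * s by rewrite /s exprD invfM mulrCA mulfV ?mulr1 // gt_eqF // exprn_gt0.
by rewrite mulrA ler_pM2r.
Qed.

(** The gaps and steps of level [N + 1] fit into the slack [(lam - 1) * s] between the covering
    radius [s] of the net and the radius [lam * s] that defines adjacency. *)
Let r's : (2 * L + 6) * r' <= (lam - 1) * s.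
Proof.
have -> : s = a ^+ j * r'.
  have e : (k * N.+1 = k * N + k' + j)%N by rewrite mulnS -addnA -kE addnC.
  by rewrite /r' e exprD invfM -/s mulrCA mulfV ?mulr1 // gt_eqF // exprn_gt0.
by rewrite mulrA ler_pM2r.
Qed.

Let r'r : r' <= r.
Proof.
have h1 : 0 < L * r' by rewrite mulr_gt0 //; have := L1; lra.
have h2 : 0 < lam * s by rewrite mulr_gt0 //; have := lam1; lra.
have := r's; have := sr; have := spos; have := r'pos; lra.
Qed.

Let bigs : s <= lam * s.
Proof. by rewrite ler_peMl ?ltW // ; have := lam1; lra. Qed.

(* A run of steps of level [N + 1] that started near [x0] and, so far, stays in the ball
   [B(v, L r)]: the centres [u1 :: q] form a path for the modulus problem at [v]. *)
Let run x0 v u1 q z x (A : R) : Prop :=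
  [/\ v \in Y (k * N), d x0 v <= 2 * r, is_pathG d a lam Xs (k * N + k') (u1, q),
      d v u1 < r & {in u1 :: q, forall w, d v w < L * r} /\
      [/\ d z (last u1 q) < s, d z x <= (L + 2) * r' &
        pi N v * (\sum_(w <- u1 :: q) rho N v w) <= A]].

Let run_near x0 v u1 q z x A w : run x0 v u1 q z x A -> d x w <= (L + 4) * r' ->
  d x0 w <= (L + 4) * r.
Proof.
case=> vV x0v _ _ [inL [zl zx _]] xw.
have lv := inL _ (mem_last u1 q).
have h1 := metric_triangle dm v x0 w; have h2 := metric_triangle dm (last u1 q) v w.
have h3 := metric_triangle dm z (last u1 q) w; have h4 := metric_triangle dm x z w.
rewrite (metric_sym dm (last u1 q) z) in h3.
have := r's; have := sr; have := bigs; have := rpos; lra.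
Qed.

Let path_from_rcons u q w : path_from d a lam Xs (k * N + k') u q -> Xs (k * N + k') w ->
  adjG d a lam (k * N + k') (last u q) w -> path_from d a lam Xs (k * N + k') u (rcons q w).
Proof.
move=> + wX; elim: q u => [|b q ih] u /=; first by split.
by case=> h1 h2 h3 h4; split => //; apply: ih.
Qed.

(** Simultaneous induction for a chain outside a run and one inside a run. A step of level [N + 1]
    opens a run; further ones extend its path. On leaving [B(v, L r)], admissibility shows that the
    run has cost at least [pi N v], which pays for one step from [v]. A run that ends earlier is
    dropped, since it fits in a gap. *)
Lemma eliminate_level l :
  (forall x, gap_chain N.+1 x l y ->
    exists2 l', gap_chain N x l' y & cost l' <= cost l) /\
  (forall x0 v u1 q z x A, run x0 v u1 q z x A -> gap_chain N.+1 x l y ->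
    exists2 l', gap_chain N x0 l' y & cost l' <= A + cost l).
Proof.
elim: l => [|[[n w] x'] l [ih1 ih2]].
  split => [x /= xy|x0 v u1 q z x A rn /= xy].
    exists [::] => //=; apply: (le_trans xy); rewrite ler_wpM2l //.
    by have := L1; lra.
  exists [::] => /=; first exact: run_near rn xy.
  rewrite /chain_cost big_nil addr0; case: rn => _ _ _ _ [_ [_ _]]; apply: le_trans.
  by rewrite mulr_ge0 // sumr_ge0.
have costE (b : nat) (z1 z2 : X) l' : cost ((b, z1, z2) :: l') = pi b z1 + cost l'.
  by rewrite /chain_cost big_cons.
split => [x /= [nN xw wx' x'l]|x0 v u1 q z x A rn /= [nN xw wx' x'l]].
  move: nN; rewrite leq_eqVlt => /orP[/eqP nE|nN]; last first.
    have [l' cl' le'] := ih1 _ x'l; exists ((n, w, x') :: l').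
      split => //; apply: (le_trans xw); rewrite ler_wpM2l //.
      by have := L1; lra.
    by rewrite !costE lerD2l.
  have [u uU wu] := Ycov (k * N + k') w; have [v vV uv] := Ycov (k * N) u.
  case: wx' => [n0|wx']; first by rewrite n0 in nE.
  rewrite costE; rewrite nE in wx' *.
  suff rn : run x v u [::] w x' (pi N.+1 w) by exact: ih2 rn x'l.
  split; [exact: vV| |by split => //=; rewrite XsY|by rewrite (metric_sym dm)|split; [|split]].
  - have h1 := metric_triangle dm w x v; have h2 := metric_triangle dm u w v.
    have h : 0 <= (L + 2) * r' by rewrite mulr_ge0 ?ltW //; have := L1; lra.
    have := r's; have := sr; have := bigs; have := rpos; rewrite -/r -/s -/r' in xw wu uv *; lra.
  - move=> b; rewrite inE => /eqP->; rewrite (metric_sym dm); apply: (lt_trans uv).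
    by rewrite -[ltLHS]mul1r ltr_pM2r.
  - exact: wu.
  - exact: wx'.
  - by rewrite big_seq1; apply: pi_step => //; exact: ltW.
(* A coarser step interrupts the run: by [run_near] the run becomes part of the gap before that
   step, and its cost [A] is given up. *)
rewrite costE; move: nN; rewrite leq_eqVlt => /orP[/eqP nE|nN]; last first.
  have [l' cl' le'] := ih1 _ x'l; exists ((n, w, x') :: l').
    by split => //; apply: run_near rn xw.
  have A0 : 0 <= A.
    by case: rn => _ _ _ _ [_ [_ _]]; apply: le_trans; rewrite mulr_ge0 // sumr_ge0.
  rewrite costE; lra.
case: wx' => [n0|wx']; first by rewrite n0 in nE.
rewrite nE in wx' *.
have [u uU wu] := Ycov (k * N + k') w.
have uX : Xs (k * N + k') u by rewrite XsY.
case: rn => vV x0v [u1X pth] vu1 [inL [zl zx cA]].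
have st : pi N v * rho N v u <= pi N.+1 w by apply: pi_step => //; exact: ltW.
have lv := inL _ (mem_last u1 q).
have gaps : (L + 2) * r' + (L + 4) * r' <= (lam - 1) * s by have := r's; lra.
have zu : d z u < lam * s.
  have h1 := metric_triangle dm x z u; have h2 := metric_triangle dm w x u.
  rewrite -/s -/r' in xw wu *; lra.
(* Adjacency requires distinct vertices, so a repeated centre leaves the path unchanged. *)
have [ul|ul] := eqVneq (last u1 q) u.
  rewrite [A + _]addrA; suff rn : run x0 v u1 q w x' (A + pi N.+1 w) by exact: ih2 rn x'l.
  split; [exact: vV|exact: x0v|by split|exact: vu1|split; [exact: inL|]].
  by rewrite ul; split => //; apply: (le_trans cA); rewrite lerDl.
have adj : adjG d a lam (k * N + k') (last u1 q) u.
  split; first exact/eqP.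
  exists z; rewrite /dball /=; split; first by rewrite (metric_sym dm); apply: lt_le_trans bigs.
  by rewrite (metric_sym dm).
have pth' : is_pathG d a lam Xs (k * N + k') (u1, rcons q u).
  by split => //; apply: path_from_rcons.
have cA' : pi N v * (\sum_(b <- u1 :: rcons q u) rho N v b) <= A + pi N.+1 w.
  rewrite -rcons_cons big_rcons /= mulrDr.
  by have := lerD cA st.
have vu : d v u < L * r + 2 * (lam * s).
  have h1 := metric_triangle dm (last u1 q) v u; have h2 := metric_triangle dm z (last u1 q) u.
  rewrite (metric_sym dm _ z) in h2; have := bigs; lra.
have [uin|uout] := ltP (d v u) (L * r).
  rewrite [A + _]addrA.
  suff rn : run x0 v u1 (rcons q u) w x' (A + pi N.+1 w) by exact: ih2 rn x'l.
  split; [exact: vV|exact: x0v|exact: pth'|exact: vu1|split].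
    by move=> b; rewrite -rcons_cons mem_rcons inE => /orP[/eqP->|/inL].
  by rewrite last_rcons.
(* The path has left [B(v, L r)]: the whole run is traded for the single step from [v] to [x'], and
   elimination restarts at [x']. *)
have [l' cl' le'] := ih1 _ x'l; exists ((N, v, x') :: l').
  split => //.
    apply: (le_trans x0v); rewrite ler_wpM2r ?(ltW rpos) //; have := L1; lra.
  right; have h1 := metric_triangle dm (last u1 q) v x'.
  have h2 := metric_triangle dm z (last u1 q) x'; have h3 := metric_triangle dm x z x'.
  have h4 := metric_triangle dm w x x'; rewrite (metric_sym dm _ z) in h2.
  have : 0 <= (L + 4) * r' by rewrite mulr_ge0 ?ltW //; have := L1; lra.
  rewrite -/r -/r' in xw wx' *; have := r's; have := sr; have := rpos; have := spos; lra.
rewrite costE addrA; apply: lerD => //.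
apply: le_trans cA'; rewrite -[leLHS]mulr1 ler_wpM2l //.
apply: (rho_adm (g := (u1, rcons q u)) vV).
  split => //; split => //; rewrite /dball /= last_rcons -/r => h.
  by move: uout; rewrite leNgt h.
move=> b /=; rewrite -/r -rcons_cons mem_rcons inE => /orP[/eqP->|/inL h].
  by have := sr; lra.
by rewrite ltW // (lt_trans h) // ltr_pM2r //; lra.
Qed.

End OneLevel.

Lemma eliminate_levels M N x l y : (M <= N)%N -> gap_chain N x l y ->
  exists2 l', gap_chain M x l' y & cost l' <= cost l.
Proof.
move=> /subnK <-; elim: (N - M)%N l => [|n ih] l cl; first by exists l.
have [l1 c1 le1] := (eliminate_level _ y l).1 x cl.
by have [l2 c2 le2] := ih _ c1; exists l2 => //; apply: le_trans le1.
Qed.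

End Eliminate.

(** * The chain metric *)

Section ChainMetric.
Context {R : realType} {X : choiceType} (d : X -> X -> R) (a : R).
Hypothesis dm : is_metric d.
Hypothesis a1 : 1 < a.
Context (k : nat) (pi : nat -> X -> R) (g c q eta delta Dm : R).
Hypothesis k0 : (0 < k)%N.
Hypothesis g1 : 1 <= g.
Hypothesis q0 : 0 < q.
Hypothesis eta0 : 0 < eta.
Hypothesis eta1 : eta < 1.
Hypothesis delta0 : 0 < delta.
Hypothesis dD : forall x y, d x y < Dm.
Hypothesis pi_gt0 : forall n x, 0 < pi n x.
Hypothesis pi_0 : forall x, pi 0%N x = 1.
Hypothesis pi_harnack : forall n x y, pi n x <= expR (q * (d x y * a ^+ (k * n))) * pi n y.
Hypothesis pi_decay : forall n x, pi n.+1 x <= eta * pi n x.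
Hypothesis pi_growth : forall n x, delta * pi n x <= pi n.+1 x.
Hypothesis elim : forall M N x l y, (M <= N)%N -> gap_chain d a k g c N x l y ->
  exists2 l', gap_chain d a k g c M x l' y & chain_cost pi l' <= chain_cost pi l.
Hypothesis c1 : 1 <= c.
Local Notation r n := (a ^- (k * n)).

Let a0 : 0 < a. Proof. by have := a1; lra. Qed.
Let r0 n : 0 < r n. Proof. by rewrite invr_gt0 exprn_gt0. Qed.

(* Steps of level 0 are unrestricted, so that any two points are joined by a chain. *)
Definition chain_step n x z := n = 0%N \/ d x z <= r n.

(** A step pays at both of its ends, so that reversing a chain preserves its length. *)
Inductive chain_length : X -> X -> R -> Prop :=
| chain_length_nil x : chain_length x x 0
| chain_length_cons n x z y t : chain_step n x z -> chain_length z y t ->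
    chain_length x y (pi n x + pi n z + t).

Lemma chain_length_cat x y z t u : chain_length x y t -> chain_length y z u ->
  chain_length x z (t + u).
Proof.
elim=> [w|n w w' w'' t' st _ ih] yz; first by rewrite add0r.
by rewrite -addrA; apply: chain_length_cons st (ih yz).
Qed.

Lemma chain_step_sym n x z : chain_step n x z -> chain_step n z x.
Proof. by case=> [->|h]; [left|right; rewrite (metric_sym dm)]. Qed.

Lemma chain_length1 n x z : chain_step n x z -> chain_length x z (pi n x + pi n z).
Proof.
by move=> st; rewrite -[_ + _]addr0; apply: chain_length_cons st (chain_length_nil z).
Qed.

Lemma chain_length_sym x y t : chain_length x y t -> chain_length y x t.
Proof.
elim=> [w|n w w' w'' t' st _ ih]; first exact: chain_length_nil.
rewrite addrC [pi n w + _]addrC; apply: chain_length_cat ih _.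
exact/chain_length1/chain_step_sym.
Qed.

Lemma chain_length_ge0 x y t : chain_length x y t -> 0 <= t.
Proof. by elim=> // n w w' w'' t' _ _ ih; rewrite !addr_ge0 // ltW. Qed.

(** A finite chain has a finest level; from that level on it is a gap chain whose gaps are all
    trivial. *)
Lemma chain_length_gap x y t : chain_length x y t ->
  exists N, forall M, (N <= M)%N ->
    exists2 l, gap_chain d a k g c M x l y & chain_cost pi l <= t.
Proof.
have gr n : 0 <= g * r n by rewrite mulr_ge0 // ?ltW //; have := g1; lra.
elim=> [w|n w w' w'' t' st _ [N ih]].
  exists 0%N => M _; exists [::]; last by rewrite /chain_cost big_nil.
  by rewrite /= (metric_self dm).
exists (maxn n N) => M; rewrite geq_max => /andP[nM NM].
have [l cl le] := ih M NM; exists ((n, w, w') :: l).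
  split => //; first by rewrite (metric_self dm).
  case: st => [->|h]; [by left|right]; apply: (le_trans h).
  by rewrite ler_peMl // ltW.
rewrite /chain_cost big_cons /= -addrA; apply: lerD => //.
by apply: (le_trans le); rewrite lerDr ltW.
Qed.

Definition chain_dist x y := inf [set t | chain_length x y t].
Local Notation theta := chain_dist.

Lemma chain_dist_le x y t : chain_length x y t -> theta x y <= t.
Proof.
by move=> h; apply: ge_inf => //; exists 0 => u; apply: chain_length_ge0.
Qed.

Lemma chain_dist_ge x y u : (forall t, chain_length x y t -> u <= t) -> u <= theta x y.
Proof.
move=> h; apply: lb_le_inf; last by move=> t; apply: h.
by exists (pi 0%N x + pi 0%N y); apply: chain_length1; left.
Qed.

Lemma pi_decay_iter n i x : pi (n + i) x <= eta ^+ i * pi n x.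
Proof.
elim: i => [|i ih]; first by rewrite addn0 mul1r.
rewrite addnS; apply: (le_trans (pi_decay _ _)).
by rewrite exprS -mulrA ler_pM2l.
Qed.

Lemma pi_growth_iter n i x : delta ^+ i * pi n x <= pi (n + i) x.
Proof.
elim: i => [|i ih]; first by rewrite addn0 mul1r.
rewrite addnS; apply: le_trans (pi_growth _ _).
by rewrite exprS -mulrA ler_pM2l.
Qed.

Lemma pi_anti n m x : (n <= m)%N -> pi m x <= pi n x.
Proof.
move=> /subnKC <-; apply: (le_trans (pi_decay_iter _ _ _)).
by rewrite ler_piMl ?exprn_ile1 // ltW.
Qed.

Lemma pi_near n x y G : d x y <= G * r n -> pi n x <= expR (q * G) * pi n y.
Proof.
move=> h; apply: (le_trans (pi_harnack _ _ y)); rewrite ler_wpM2r ?(ltW (pi_gt0 _ _)) //.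
by rewrite ler_expR ler_pM2l // -ler_pdivlMr // exprn_gt0.
Qed.

Definition upper_const := 1 + expR q.
Definition lower_const := expR (- (q * g)).
Local Notation cu := upper_const.
Local Notation cl := lower_const.

Let cu1 : 1 <= cu. Proof. by rewrite lerDl expR_ge0. Qed.
Let cu0 : 0 < cu. Proof. exact: lt_le_trans cu1. Qed.
Let cl0 : 0 < cl. Proof. exact: expR_gt0. Qed.
Let cl1 : cl <= 1.
Proof.
by rewrite -[leRHS]expR0 ler_expR oppr_le0 mulr_ge0 ?(ltW q0) //; have := g1; lra.
Qed.

Lemma chain_dist_upper n x y : chain_step n x y -> theta x y <= cu * pi n x.
Proof.
move=> st; apply: (le_trans (chain_dist_le (chain_length1 st))).
rewrite mulrDl mul1r lerD2l; case: st => [->|h].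
  by rewrite !pi_0 mulr1 -[leLHS]expR0 ler_expR ltW.
by rewrite -[q]mulr1; apply: pi_near; rewrite mul1r (metric_sym dm).
Qed.

(** Eliminate all levels finer than [N]. The chain left cannot be empty, as one gap does not reach
    [y]; its first step has level at most [N] and starts within [g * r N] of [x], so it alone costs
    enough. *)
Lemma chain_dist_lower N x y : g * r N < d x y -> cl * pi N x <= theta x y.
Proof.
move=> far; apply: chain_dist_ge => t /chain_length_gap[M hM].
have [l gl lt] := hM _ (leq_maxr N M).
have [l' gl' le'] := elim (leq_maxl N M) gl; have {le'}le' := le_trans le' lt.
case: l' => [|[[n z] x'] l'] /= in gl' le' *.
- by move: far; rewrite ltNge gl'.
- case: gl' => nN xz _ _; apply: le_trans le'.
  rewrite /chain_cost big_cons /=; apply: (@le_trans _ _ (pi n z)); last first.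
    by rewrite lerDl; apply: sumr_ge0 => e _; apply: ltW.
  rewrite mulrC -ler_pdivlMr // /cl expRN invrK mulrC.
  apply: (le_trans (pi_anti x nN)); apply: pi_near.
  apply: (le_trans xz); rewrite ler_wpM2l //; first by have := g1; lra.
  by rewrite lef_pV2 ?posrE ?exprn_gt0 // ler_weXn2l ?leq_mul2l ?nN ?orbT // ltW.
Qed.

Lemma chain_dist_metric : is_metric theta.
Proof.
have sym x y : theta x y <= theta y x.
  by apply: chain_dist_ge => t h; apply/chain_dist_le/chain_length_sym.
split.
- by move=> x y; apply: chain_dist_ge => t; apply: chain_length_ge0.
- move=> x y; split => [e|->]; last first.
    apply/le_anti; rewrite (chain_dist_le (chain_length_nil y)) /=.
    by apply: chain_dist_ge => t; apply: chain_length_ge0.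
  apply: contrapT => xy; have dp := metric_gt0 dm xy.
  have g0 : 0 < g by have := g1; lra.
  have [K hK] := exprV_small a1 (divr_gt0 dp (mulr_gt0 g0 (ltr0n R 2))).
  have h : g * r K < d x y.
    have : r K <= d x y / (g * 2) by apply: hK; rewrite leq_pmull.
    rewrite ler_pdivlMr ?mulr_gt0 //; lra.
  by have := chain_dist_lower h; rewrite e leNgt mulr_gt0.
- by move=> x y; apply/le_anti; rewrite !sym.
- move=> x y z; rewrite -lerBlDr; apply: chain_dist_ge => t xy.
  rewrite lerBlDr -lerBlDl; apply: chain_dist_ge => u yz.
  by rewrite lerBlDl; apply/chain_dist_le/(chain_length_cat xy).
Qed.

Let b := a ^+ k.
Let b1 : 1 < b. Proof. by rewrite /b exprn_egt1 // gt_eqF. Qed.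
Let b0 : 0 < b. Proof. exact: lt_trans b1. Qed.
Let rE n : r n = b ^- n. Proof. by rewrite exprM. Qed.

Let delta_eta (x0 : X) : delta <= eta.
Proof. by have := le_trans (pi_growth 0 x0) (pi_decay 0 x0); rewrite ler_pM2r. Qed.

(** [G * r n] dominates the gap [g * r n], and at level 0 also the diameter. *)
Let G := Num.max g Dm.
Let G1 : 1 <= G. Proof. by rewrite le_max g1. Qed.

Lemma level_above x u : x <> u -> exists2 n, chain_step n x u & r n.+1 < d x u.
Proof.
move=> xu; have dp := metric_gt0 dm xu.
have dp2 : 0 < d x u / 2 by lra.
have [K hK] := exprV_small b1 dp2.
have ex : exists n, r n.+1 < d x u.
  by exists K; rewrite rE; apply: (le_lt_trans (hK _ (leqnSn K))); lra.
case: (ex_minnP ex) => n h mn; exists n => //.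
case: n h mn => [|n] h mn; [by left|right].
by rewrite leNgt; apply/negP => h2; have := mn n h2; rewrite ltnn.
Qed.

(** Take the first level whose gap is shorter than [d x v]. The previous gap gives the upper bound
    with a loss of [b]; at level 0 there is no previous one and the diameter bound replaces it. *)
Lemma level_below x v : x <> v -> exists2 N, g * r N < d x v & d x v <= G * b * r N.
Proof.
move=> xv; have dp := metric_gt0 dm xv.
have g0 : 0 < g by have := g1; lra.
have [K hK] := exprV_small b1 (divr_gt0 dp (mulr_gt0 g0 (ltr0n R 2))).
have ex : exists n, g * r n < d x v.
  exists K; rewrite rE; have := hK _ (leqnn K); rewrite ler_pdivlMr ?mulr_gt0 //; lra.
case: (ex_minnP ex) => N h mn; exists N => //.
case: N h mn => [|n] h mn.
  rewrite muln0 expr0 invr1 mulr1; apply: (le_trans (ltW (dD x v))).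
  apply: (@le_trans _ _ G); first by rewrite le_max lexx orbT.
  by rewrite ler_peMr ?ltW //; apply: lt_le_trans G1.
have : d x v <= g * r n.
  by rewrite leNgt; apply/negP => h2; have := mn n h2; rewrite ltnn.
rewrite !rE exprS invfM -[G * b * _]mulrA mulVKf ?gt_eqF //.
have bn : 0 <= b ^- n by rewrite invr_ge0 exprn_ge0 // ltW.
move=> h2; apply: (le_trans h2); apply: ler_wpM2r => //.
by rewrite /G le_max lexx.
Qed.

Let powR_interp (t x y : R) : 0 <= t -> 0 < x -> x^-1 <= y -> y <= x ->
  powR t y <= Num.max (powR t x) (powR t x^-1).
Proof.
move=> t0 x0 xy yx; rewrite le_max; have [t1|t1] := leP 1 t.
  by apply/orP; left; apply: ler_powR.
move: t0; rewrite le_eqVlt => /orP[/eqP<-|t0].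
  rewrite powR0; first by rewrite powR_ge0.
  by rewrite gt_eqF //; apply: lt_le_trans xy; rewrite invr_gt0.
by apply/orP; right; apply: ger_powR => //; rewrite t0 ltW.
Qed.

Lemma expr_powR_log (e : R) i : 0 < e -> e ^+ i = powR (b ^- i) (- ln e / ln b).
Proof.
move=> e0; have lb : 0 < ln b by rewrite ln_gt0.
have bi : 0 < b ^- i by rewrite invr_gt0 exprn_gt0.
rewrite /powR gt_eqF // lnV ?posrE ?exprn_gt0 // lnXn //.
rewrite -[e in LHS]lnK ?posrE // -expRM_natl; congr expR.
by rewrite -mulr_natl; field; rewrite gt_eqF.
Qed.

(** With [n] and [N] the levels of [d x u] and [d x v], the ratio of distances is comparable to
    [pi n x / pi N x]. Decay bounds this by the power [s] of the scale ratio when [N <= n], growth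
    by the power [s'] when [n < N]. *)
Lemma chain_dist_power_quasisymmetric : power_quasisymmetric d theta.
Proof.
have [[x0 _]|nX] := pselect (exists x : X, True); last first.
  by exists 1, 1; split => // x; case: nX; exists x.
have de := delta_eta x0.
have lb : 0 < ln b by rewrite ln_gt0.
pose s := - ln eta / ln b; pose s' := - ln delta / ln b.
have s0 : 0 < s by rewrite divr_gt0 // oppr_gt0 ln_lt0 // eta0.
have ss' : s <= s'.
  by rewrite ler_pM2r ?invr_gt0 // lerN2 ler_ln ?posrE.
pose alpha := Num.max 1 (Num.max s' s^-1).
have al1 : 1 <= alpha by rewrite le_max lexx.
have al0 : 0 < alpha by apply: lt_le_trans al1.
have als : alpha^-1 <= s.
  by rewrite -[leRHS]invrK lef_pV2 ?posrE ?invr_gt0 // !le_max lexx !orbT.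
have als' : s' <= alpha by rewrite !le_max lexx !orbT.
(* [K] absorbs the rounding of both distances to levels; [alpha] was taken so that [s] and [s'] lie
   between [alpha^-1] and [alpha]. *)
pose K := G * b * b.
have K1 : 1 <= K.
  by rewrite /K; apply: mulr_ege1; [apply: mulr_ege1 => //|]; exact: ltW.
pose C := Num.max 1 (cu / cl * powR K s').
exists C, alpha; split => //; first by rewrite le_max lexx.
move=> x u v xv; have tm := chain_dist_metric.
have K0 : 0 <= K by apply: le_trans K1.
set t := d x u / d x v; set RHS := (X in C * X).
have t0 : 0 <= t by rewrite divr_ge0 // metric_ge0.
have RHS0 : 0 <= RHS by rewrite le_max powR_ge0.
have [xu|/eqP xu] := eqVneq x u.
  rewrite -xu (metric_self tm) mul0r mulr_ge0 //.
  by apply: (le_trans ler01); rewrite le_max lexx.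
have [n st fu] := level_above xu; have [N fv uv] := level_below xv.
have up := chain_dist_upper st; have lo := chain_dist_lower fv.
have main beta : s <= beta -> beta <= s' -> pi n x / pi N x <= powR (K * t) beta ->
    theta x u / theta x v <= C * RHS.
  move=> sb bs' h; apply: (@le_trans _ _ (cu / cl * (pi n x / pi N x))).
    rewrite ler_pdivrMr; last exact: (metric_gt0 tm).
    apply: (le_trans up).
    have -> : cu / cl * (pi n x / pi N x) * theta x v = cu * (pi n x * (theta x v / (cl * pi N x))).
      by field; rewrite !gt_eqF.
    apply: ler_wpM2l; first by apply: le_trans cu1.
    rewrite ler_peMr ?(ltW (pi_gt0 _ _)) // ler_pdivlMr ?mulr_gt0 // mul1r; exact: lo.
  have cc : 0 <= cu / cl by rewrite ltW // divr_gt0.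
  apply: (le_trans (ler_wpM2l cc h)); rewrite powRM //.
  rewrite mulrA; apply: ler_pM; [exact: mulr_ge0 cc (powR_ge0 _ _)|exact: powR_ge0| |].
    rewrite /C le_max; apply/orP; right; apply: ler_wpM2l => //.
    exact: ler_powR.
  apply: powR_interp => //; [exact: le_trans sb|exact: le_trans als'].
have dv := metric_gt0 dm xv.
have tK : b ^- n * b ^+ N <= K * t.
  rewrite /t mulrA ler_pdivlMr //; rewrite rE in uv; rewrite rE exprS invfM in fu.
  have h1 : b ^- n * b ^+ N * d x v <= b ^- n * b ^+ N * (G * b / b ^+ N).
    by apply: ler_wpM2l uv; rewrite mulr_ge0 ?invr_ge0 ?exprn_ge0 // ltW.
  apply: (le_trans h1).
  have -> : b ^- n * b ^+ N * (G * b / b ^+ N) = K * (b^-1 * b ^- n).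
    by rewrite /K; field; rewrite !gt_eqF ?exprn_gt0.
  by rewrite ler_wpM2l // ltW.
have [nN|nN] := leqP N n.
  apply: (main s) => //; rewrite ler_pdivrMr // -{1}(subnKC nN).
  apply: (le_trans (pi_decay_iter _ _ _)); rewrite ler_wpM2r ?(ltW (pi_gt0 _ _)) //.
  rewrite expr_powR_log // -/s; apply: ge0_ler_powR; rewrite ?nnegrE ?(ltW s0) //.
  - by rewrite invr_ge0 exprn_ge0 // ltW.
  - by rewrite mulr_ge0.
  - apply: le_trans tK; rewrite -{2}(subnK nN) exprD invfM -mulrA mulVf ?mulr1 //.
    by rewrite gt_eqF // exprn_gt0.
apply: (main s') => //.
have h := pi_growth_iter n (N - n) x; rewrite subnKC ?(ltW nN) // in h; last exact: ltnW.
apply: (@le_trans _ _ (delta ^- (N - n))).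
  by rewrite ler_pdivrMr // mulrC ler_pdivlMr ?exprn_gt0 // mulrC.
rewrite expr_powR_log // -/s' -powRN.
have -> : powR (b ^- (N - n)) (- s') = powR (b ^+ (N - n)) s'.
  by rewrite powRN /powR !gt_eqF ?invr_gt0 ?exprn_gt0 // lnV ?posrE ?exprn_gt0 // mulrN expRN invrK.
apply: ge0_ler_powR; rewrite ?nnegrE.
- exact: le_trans (ltW s0) ss'.
- by rewrite exprn_ge0 // ltW.
- by rewrite mulr_ge0.
- apply: le_trans tK; rewrite -{2}(subnKC (ltnW nN)) exprD mulKf //.
  by rewrite gt_eqF // exprn_gt0.
Qed.

(** * Assouad bound for the chain metric *)

Context (Y : nat -> seq X) (p Mt : R).
Hypothesis Ycov : forall n x, exists2 u, u \in Y n & d x u < a ^- n.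
Hypothesis p0 : 0 < p.
Hypothesis Mt0 : 0 < Mt.
Hypothesis mass : forall m N x,
  \sum_(n < N) \sum_(z <- Y (k * (m + n)))
    expR (- 2 * (d x z * a ^+ (k * m))) * powR (pi (m + n) z) p <= Mt * powR (pi m x) p.

Lemma pi_small e : 0 < e -> exists N, forall x m n, (N <= n)%N -> cu * pi (m + n) x < e.
Proof.
move=> e0; have i1 : 1 < eta^-1 by rewrite -[ltLHS]invr1 ltf_pV2 ?posrE.
have e20 : 0 < e / (2 * cu) by rewrite divr_gt0 // mulr_gt0.
have [N hN] := exprV_small i1 e20; exists N => x m n Nn.
have h := hN n Nn; rewrite exprVn invrK in h.
have h2 : pi (m + n) x <= eta ^+ n.
  rewrite addnC; apply: (le_trans (pi_anti x (leq_addr m n))).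
  by have := pi_decay_iter 0 n x; rewrite pi_0 mulr1.
have : cu * pi (m + n) x <= cu * (e / (2 * cu)).
  by rewrite ler_pM2l //; apply: le_trans h.
by have -> : cu * (e / (2 * cu)) = e / 2; [field; rewrite gt_eqF|lra].
Qed.

Lemma size_flatten_map (T : Type) (f : nat -> seq T) N :
  (size (flatten [seq f n | n <- iota 0 N]))%:R = \sum_(n < N) (size (f n))%:R :> R.
Proof.
rewrite size_flatten sumnE /shape -map_comp big_map natr_sum.
by rewrite -{1}[N]subn0 -/(index_iota 0 N) big_mkord.
Qed.

(** Let [m] precede the first level with [cl * pi n x < t]. Points farther than [g * r m] are then
    at [theta]-distance at least [cl * pi m x >= t], and growth bounds the loss of one level by
    [delta]. *)
Lemma chain_ball_level x t : 0 < t -> exists m,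
  cl * delta * pi m x <= t /\ (forall y, theta x y < t -> d x y <= G * r m).
Proof.
move=> t0; have de := delta_eta x.
have d1 : delta <= 1 by apply: (le_trans de); exact: ltW.
have [N hN] := pi_small t0.
have ex : exists n, cl * pi n x < t.
  exists N; have := hN x 0%N N (leqnn _); rewrite add0n; apply: le_lt_trans.
  by rewrite ler_pM2r //; apply: le_trans cu1.
case: (ex_minnP ex) => [[|m]] h mn.
  exists 0%N; split.
    rewrite pi_0 mulr1; rewrite pi_0 mulr1 in h; apply: le_trans (ltW h).
    by rewrite ger_pMr.
  move=> y _; rewrite muln0 expr0 invr1 mulr1; apply: (le_trans (ltW (dD x y))).
  by rewrite le_max lexx orbT.
exists m; split.
  by apply: le_trans (ltW h); rewrite -mulrA ler_pM2l.
move=> y xy; rewrite leNgt; apply/negP => far.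
have : cl * pi m x <= theta x y.
  apply: chain_dist_lower; apply: le_lt_trans far; rewrite ler_pM2r // le_max lexx //.
by move=> h2; have := mn m (le_lt_trans h2 xy); rewrite ltnn.
Qed.

(* For [y] in the ball, stop at the first level [m + n] where [pi (m + n) y] is below about [t]
   and take a net point [z] near [y]; its mass is at least about [(min t (pi m x)) ^ p].  The
   stopped points of different levels may overlap: the masses of all levels are summable. *)
Lemma chain_dist_assouad : exists2 C, 0 < C & assouad_bound theta C p.
Proof.
(* The factors of [kappa] are the losses in bounding [pi] at [z] from below: [delta] and [cu] from
   stopping one level late, [q * G] from passing from [x] to [y], and [q] from [y] to [z]. *)
pose kappa := delta * expR (- (q * (G + 1))) / cu.
have kap0 : 0 < kappa by rewrite divr_gt0 // mulr_gt0 // expR_gt0.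
pose w := expR (- 2 * (G + 1)); have w0 : 0 < w by apply: expR_gt0.
pose C := Mt / w * powR (kappa * (cl * delta)) (- p).
have kcd : 0 < kappa * (cl * delta) by rewrite mulr_gt0 // mulr_gt0.
have C0 : 0 < C by rewrite mulr_gt0 ?divr_gt0 // powR_gt0.
exists C => // x t Rr t0 tR; have R0 : 0 < Rr by apply: lt_trans tR.
have de := delta_eta x.
have d1 : delta <= 1 by apply: (le_trans de); exact: ltW.
have [m [mR mB]] := chain_ball_level x R0.
pose pm := pi m x; have pm0 : 0 < pm by apply: pi_gt0.
pose h := kappa * Num.min t pm; have h0 : 0 < h by rewrite mulr_gt0 // lt_min t0.
have [N hN] := pi_small t0.
pose f n := [seq z <- Y (k * (m + n)) | (d x z <= (G + 1) * r m) && (h <= pi (m + n) z)].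
pose cs := flatten [seq f n | n <- iota 0 N.+1].
have cov : dball theta x Rr `<=` [set y | exists2 z, z \in cs & dball theta z t y].
  move=> y xy; have yB := mB y xy.
  have ex : exists n, cu * pi (m + n) y < t by exists N; apply: hN.
  case: (ex_minnP ex) => n yn mn; have nN : (n <= N)%N by apply: mn; apply: hN.
  have [z zY yz] := Ycov (k * (m + n)) y.
  have rm : r (m + n) <= r m.
    by rewrite lef_pV2 ?posrE ?exprn_gt0 // ler_weXn2l ?leq_mul2l ?leq_addr ?orbT // ltW.
  exists z; last first.
    rewrite /dball /= (metric_sym chain_dist_metric); apply: le_lt_trans yn.
    by apply: chain_dist_upper; right; exact: ltW.
  apply/flattenP; exists (f n); first by apply: map_f; rewrite mem_iota add0n ltnS.
  rewrite mem_filter zY andbT; apply/andP; split.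
    by have := metric_triangle dm y x z; lra.
  have zy : expR (- q) * pi (m + n) y <= pi (m + n) z.
    rewrite expRN mulrC ler_pdivrMr ?expR_gt0 // mulrC -[q in expR q]mulr1.
    by apply: pi_near; rewrite mul1r ltW.
  have low : delta * expR (- (q * G)) / cu * Num.min t pm <= pi (m + n) y.
    have E0 : 0 < expR (- (q * G)) by apply: expR_gt0.
    have E1 : expR (- (q * G)) <= 1.
      by rewrite -[leRHS]expR0 ler_expR oppr_le0 mulr_ge0 ?(ltW q0) // (le_trans ler01).
    case: n mn yn {yz nN zY rm zy} => [|n] mn yn.
      rewrite addn0; have hy : expR (- (q * G)) * pm <= pi m y.
        rewrite expRN mulrC ler_pdivrMr ?expR_gt0 // mulrC; exact: pi_near yB.
      apply: le_trans hy; rewrite mulrAC ler_pdivrMr //.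
      have h1 : Num.min t pm <= pm by rewrite ge_min lexx orbT.
      have h2 : delta * expR (- (q * G)) * Num.min t pm <= 1 * expR (- (q * G)) * pm.
        apply: ler_pM => //; last by rewrite ler_wpM2r // ltW.
          by rewrite mulr_ge0 // ltW.
        by rewrite le_min !ltW.
      by apply: (le_trans h2); rewrite mul1r ler_peMr // mulr_ge0 // ltW.
    have yn' : t <= cu * pi (m + n) y.
      by rewrite leNgt; apply/negP => h2; have := mn n h2; rewrite ltnn.
    rewrite addnS; apply: le_trans (pi_growth _ _); rewrite -!mulrA ler_pM2l //.
    have h1 : Num.min t pm <= cu * pi (m + n) y by apply: le_trans yn'; rewrite ge_min lexx.
    have h2 : expR (- (q * G)) * (cu^-1 * Num.min t pm) <= 1 * (cu^-1 * (cu * pi (m + n) y)).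
      apply: ler_pM; [exact: ltW| |exact: E1|].
        by rewrite mulr_ge0 ?invr_ge0 ?(ltW cu0) // le_min !ltW.
      by rewrite ler_pM2l // invr_gt0.
    by apply: (le_trans h2); rewrite mul1r mulKf // gt_eqF.
  apply: le_trans zy.
  have -> : h = expR (- q) * (delta * expR (- (q * G)) / cu * Num.min t pm).
    by rewrite /h /kappa mulrDr mulr1 opprD expRD; ring.
  by rewrite ler_pM2l // expR_gt0.
apply: (@le_trans _ _ ((size cs)%:R%:E)).
  by apply: ge_ereal_inf; exists (size cs)%:R%:E => //; exists cs.
rewrite lee_fin size_flatten_map.
have each n : w * powR h p * (size (f n))%:R <=
    \sum_(z <- Y (k * (m + n))) expR (- 2 * (d x z * a ^+ (k * m))) * powR (pi (m + n) z) p.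
  rewrite -sum1_size natr_sum mulr_sumr big_filter big_mkcond /=.
  apply: ler_sum => z _; case: ifP => [/andP[xz hz]|_]; last first.
    by rewrite mulr_ge0 ?expR_ge0 ?powR_ge0.
  rewrite mulr1; apply: ler_pM; rewrite ?powR_ge0 ?(ltW w0) //.
    rewrite /w ler_expR !mulNr lerN2 ler_pM2l //.
    by rewrite -ler_pdivlMr // exprn_gt0.
  by apply: ge0_ler_powR; rewrite ?nnegrE ?(ltW p0) ?(ltW h0) ?(ltW (pi_gt0 _ _)).
have total : w * powR h p * (\sum_(n < N.+1) (size (f n))%:R) <= Mt * powR pm p.
  apply: le_trans (mass m N.+1 x); rewrite mulr_sumr; apply: ler_sum => n _; exact: each.
have hp0 : 0 < powR h p by rewrite powR_gt0.
have wh0 : 0 < w * powR h p by rewrite mulr_gt0.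
rewrite mulrC -ler_pdivlMr // in total; apply: (le_trans total).
have -> : Mt * powR pm p / (w * powR h p) = Mt / w * (powR pm p / powR h p).
  by field; rewrite !gt_eqF.
have Rt0 : 0 < Rr / t by rewrite divr_gt0.
have -> : C * powR (Rr / t) p = Mt / w * (powR (Rr / t) p / powR (kappa * (cl * delta)) p).
  by rewrite /C powRN -[LHS]mulrA [powR (Rr / t) p * _]mulrC.
rewrite ler_pM2l ?divr_gt0 // ler_pdivrMr // mulrAC ler_pdivlMr ?powR_gt0 //.
rewrite -!powRM ?(ltW pm0) ?(ltW kcd) ?(ltW Rt0) ?(ltW h0) //.
apply: ge0_ler_powR; [exact: ltW|by rewrite nnegrE ltW // mulr_gt0|
  by rewrite nnegrE ltW // mulr_gt0|].
(* If the minimum is [t], the claim is the choice of [m], namely [cl * delta * pm <= Rr]; if it is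
   [pm], it follows from [t < Rr]. *)
rewrite [leRHS]mulrAC ler_pdivlMr // /h.
have -> : Rr * (kappa * Num.min t pm) = kappa * (Rr * Num.min t pm) by ring.
have -> : pm * (kappa * (cl * delta)) * t = kappa * (cl * delta * pm * t) by ring.
rewrite ler_pM2l // minEle; case: ifP => _; first by rewrite ler_pM2r.
have -> : cl * delta * pm * t = cl * delta * t * pm by ring.
rewrite ler_pM2r //; apply: le_trans (ltW tR); rewrite ler_piMl ?(ltW t0) //.
by rewrite -[leRHS](mulr1 1); apply: ler_pM => //; exact: ltW.
Qed.
End ChainMetric.

(** * Power quasisymmetries and conclusion *)

Section PowerHomeo.
Import numFieldNormedType.Exports.
Context {R : realType}.

(** The preimages of [f x + e] and [f x - e] bound a neighbourhood of [x] that works; when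
    [f x - e < 0] there is no preimage, but the lower estimate is then trivial. *)
Lemma increasing_bijection_continuous (f f' : R -> R) :
  (forall t, 0 <= t -> [/\ 0 <= f t, 0 <= f' t, f' (f t) = t & f (f' t) = t]) ->
  (forall s t, 0 <= s -> s <= t -> f s <= f t) ->
  {within [set t : R | 0 <= t], continuous f}.
Proof.
move=> h mono; apply/subspace_continuousP => x /= x0.
apply/cvgrPdist_le => e e0; rewrite near_withinE.
have [fx0 _ fK _] := h x x0.
have up0 : 0 <= f x + e by rewrite addr_ge0 // ltW.
have [_ up1 _ up2] := h _ up0.
have xup : x < f' (f x + e).
  rewrite ltNge; apply/negP => /(mono _ _ up1); rewrite up2; lra.
have [d1 d10 low] : exists2 d1, 0 < d1 & forall y, 0 <= y -> x - y < d1 -> f x - e <= f y.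
  have [sm|bg] := ltP (f x - e) 0.
    exists 1 => // y y0 _; apply: (le_trans (ltW sm)); by case: (h y y0).
  have [_ lo1 _ lo2] := h _ bg; exists (x - f' (f x - e)).
    by rewrite subr_gt0 ltNge; apply/negP => /(mono _ _ x0); rewrite lo2; lra.
  by move=> y y0 xy; rewrite -lo2; apply: mono => //; lra.
apply/nbhs_ballP; exists (Num.min d1 (f' (f x + e) - x)).
  by rewrite /= lt_min d10 subr_gt0.
move=> y /=; rewrite /ball /= lt_min => /andP[] /ltr_normlP[_ xy] /ltr_normlP[yx _] y0.
have h1 := low y y0 xy.
have h2 : f y <= f x + e by rewrite -up2; apply: mono => //; lra.
have h3 : f x - f y <= e by lra.
have h4 : - e <= f x - f y by lra.
by rewrite ler_norml; apply/andP.
Qed.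

(** The maximum of two powers in a power quasisymmetry, written piecewise: inverting the exponents
    inverts the function. *)
Definition pow2 (u v : R) (t : R) := if t <= 1 then powR t u else powR t v.

Let powR_ge1 (t v : R) : 0 <= v -> 1 <= t -> 1 <= powR t v.
Proof. by move=> v0 t1; rewrite -[leLHS](powRr0 t) ler_powR. Qed.

Let powR_le1 (t v : R) : 0 <= v -> 0 <= t -> t <= 1 -> powR t v <= 1.
Proof.
move=> v0 t0 t1; apply: (@le_trans _ _ (powR 1 v)); last by rewrite powR1.
by apply: ge0_ler_powR; rewrite ?nnegrE.
Qed.

Lemma pow2K u v t : 0 < u -> 0 < v -> 0 <= t -> pow2 u^-1 v^-1 (pow2 u v t) = t.
Proof.
move=> u0 v0 t0; rewrite /pow2; case: (leP t 1) => t1.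
  by rewrite (powR_le1 (ltW u0) t0 t1) -powRrM mulfV ?gt_eqF // powRr1.
have h : 1 < powR t v.
  rewrite -[ltLHS](powRr0 t) /powR; case: ifP => [/eqP tz|_]; first by move: t1; rewrite tz; lra.
  by rewrite ltr_expR mul0r mulr_gt0 // ln_gt0.
by rewrite leNgt h /= -powRrM mulfV ?gt_eqF // powRr1.
Qed.

Lemma pow2_mono u v s t : 0 < u -> 0 < v -> 0 <= s -> s <= t -> pow2 u v s <= pow2 u v t.
Proof.
move=> u0 v0 s0 st; have t0 := le_trans s0 st; rewrite /pow2.
case: (leP s 1) => s1; case: (leP t 1) => t1.
- by apply: ge0_ler_powR; rewrite ?nnegrE // ltW.
- by apply: (@le_trans _ _ 1); [apply: powR_le1|apply: powR_ge1]; rewrite // ltW.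
- by move: s1; rewrite ltNge (le_trans st).
- by apply: ge0_ler_powR; rewrite ?nnegrE // ltW.
Qed.

Lemma pow2_ge0 u v t : 0 <= pow2 u v t.
Proof. by rewrite /pow2; case: ifP => _; apply: powR_ge0. Qed.

Lemma max_powR_pow2 (x t : R) : 1 <= x -> 0 <= t ->
  Num.max (powR t x) (powR t x^-1) = pow2 x^-1 x t.
Proof.
move=> x1 t0; have x0 : 0 < x by apply: lt_le_trans x1.
have xx : x^-1 <= x by apply: (le_trans _ x1); rewrite invf_le1.
rewrite /pow2; case: (leP t 1) => t1.
  apply/max_idPr; case: (eqVneq t 0) => [->|tn0].
    by rewrite !powR0 // gt_eqF // invr_gt0.
  by apply: ger_powR => //; rewrite t1 andbT lt_neqAle eq_sym tn0.
by apply/max_idPl; apply: ler_powR => //; exact: ltW.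
Qed.

Lemma homeo_nonneg_pow2 (C u v : R) : 0 < C -> 0 < u -> 0 < v ->
  homeo_nonneg (fun t => C * pow2 u v t).
Proof.
move=> C0 u0 v0; exists (fun t => pow2 u^-1 v^-1 (t / C)).
have u0' : 0 < u^-1 by rewrite invr_gt0.
have v0' : 0 < v^-1 by rewrite invr_gt0.
have inv t : 0 <= t -> [/\ 0 <= C * pow2 u v t, 0 <= pow2 u^-1 v^-1 (t / C),
    pow2 u^-1 v^-1 (C * pow2 u v t / C) = t & C * pow2 u v (pow2 u^-1 v^-1 (t / C)) = t].
  move=> t0; have tC : 0 <= t / C by rewrite divr_ge0 // ltW.
  split; [by rewrite mulr_ge0 ?pow2_ge0 // ltW|exact: pow2_ge0| |].
    by rewrite mulrAC mulfV ?gt_eqF // mul1r pow2K.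
  have := pow2K u0' v0' tC; rewrite !invrK => ->.
  by rewrite mulrC divfK // gt_eqF.
split; first exact: inv.
- apply: (increasing_bijection_continuous inv) => s t s0 st.
  by rewrite ler_pM2l //; apply: pow2_mono.
- apply: (@increasing_bijection_continuous _ (fun t => C * pow2 u v t)).
    by move=> t /inv[].
  move=> s t s0 st; apply: pow2_mono => //; first by rewrite divr_ge0 // ltW.
  by rewrite ler_pM2r // invr_gt0.
Qed.

Lemma power_quasisymmetric_quasisymmetric (X : choiceType) (d theta : X -> X -> R) :
  is_metric d -> power_quasisymmetric d theta -> quasisymmetric d theta.
Proof.
move=> dm [C [alpha [C1 al1 h]]].
have al0 : 0 < alpha by apply: lt_le_trans al1.
exists (fun t => C * pow2 alpha^-1 alpha t).
  by apply: homeo_nonneg_pow2 => //; rewrite ?invr_gt0 //; apply: lt_le_trans C1.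
move=> x u v xv; apply: (le_trans (h x u v xv)); rewrite max_powR_pow2 //.
by rewrite divr_ge0 // (metric_ge0 dm).
Qed.

End PowerHomeo.

(** * Metrics in the power gauge from vanishing modulus *)

Section LowerBound.
Context {R : realType} {X : choiceType} (d : X -> X -> R) (a lam L : R).
Context (Xs : nat -> set X) (Y : nat -> seq X).
Hypothesis dm : is_metric d.
Hypothesis a1 : 1 < a.
Hypothesis lam1 : 1 < lam.
Hypothesis L1 : 1 < L.
Hypothesis XsY : forall n, Xs n = [set` Y n].
Hypothesis Yuniq : forall n, uniq (Y n).
Hypothesis Ysep : forall n, {in Y n &, forall u v, u <> v -> a ^- n <= d u v}.
Hypothesis Ycov : forall n x, exists2 u, u \in Y n & d x u < a ^- n.
Hypothesis Xne : exists x : X, True.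
Context (C b Dm : R).
Hypothesis C0 : 0 < C.
Hypothesis b0 : 0 < b.
Hypothesis ab : assouad_bound d C b.
Hypothesis dD : forall x y, d x y < Dm.

Let a0 : 0 < a. Proof. by have := a1; lra. Qed.

(* An almost optimal weight, cut off outside [B(v, (L + 1) a^-m)] and raised to at least [delta]
   inside, where [delta] is small compared with the number of vertices there. *)
Lemma local_weights (p e M1 : R) k' : 0 < p -> 0 < e -> 0 < M1 ->
  (forall n x, \sum_(u <- Y n) expR (- 1 * (d x u * a ^+ n)) <= M1) ->
  (Mpk d a lam Xs p L k' < (e / 2)%:E)%E ->
  exists2 delta, 0 < delta & exists rho : nat -> X -> X -> R, forall m v,
  [/\ forall u, 0 <= rho m v u,
    forall u, L + 1 < d v u * a ^+ m -> rho m v u = 0,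
    forall u, d v u * a ^+ m <= L + 1 -> delta <= rho m v u &
    v \in Y m -> \sum_(u <- Y (m + k')) powR (rho m v u) p <= e /\
    forall g, GammaKL d a lam Xs L k' v m g ->
      {in g.1 :: g.2, forall w, d v w <= (L + 1) * a ^- m} ->
      1 <= \sum_(w <- g.1 :: g.2) rho m v w].
Proof.
move=> p0 e0 M10 M1P Me.
(* A bound for the number of vertices in the ball, whose indicator is at most
   [expR ((L + 1) * a ^+ k')] times the exponential kernel. Raising the weight to [delta] then adds
   at most [powR delta p * Cnt = e / 2]. *)
pose Cnt := M1 * expR ((L + 1) * a ^+ k').
have Cnt0 : 0 < Cnt by rewrite mulr_gt0 // expR_gt0.
pose delta := powR (e / 2 / Cnt) p^-1.
have e20 : 0 < e / 2 / Cnt by rewrite !divr_gt0.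
have delta0 : 0 < delta by rewrite powR_gt0.
have deltap : powR delta p * Cnt = e / 2.
  by rewrite /delta -powRrM mulVf ?gt_eqF // powRr1 ?ltW // divfK // gt_eqF.
exists delta => //.
have /choice[rho hrho] : forall mv : nat * X, exists rho : X -> R, (forall u, 0 <= rho u) /\
    (mv.2 \in Y mv.1 -> \sum_(u <- Y (mv.1 + k')) powR (rho u) p <= e / 2 /\
     forall g, GammaKL d a lam Xs L k' mv.2 mv.1 g ->
       1 <= \sum_(w <- undup (g.1 :: g.2)) rho w).
  case=> m v /=; case: (boolP (v \in Y m)) => [vY|_]; last by exists (fun=> 0).
  have : (modG Xs p (m + k') (GammaKL d a lam Xs L k' v m) < (e / 2)%:E)%E.
    apply: le_lt_trans Me; apply: ereal_sup_ubound; exists (v, m) => //=.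
    by rewrite XsY.
  move=> /ereal_inf_lt[_ [rho [rho0 adm] <-]].
  rewrite lte_fin XsY -fsbig_seq // => /ltW le; exists rho; split => // _; split => // g /adm.
  by rewrite path_verts_sum.
exists (fun m v u => if d v u * a ^+ m <= L + 1 then Num.max (rho (m, v) u) delta else 0).
move=> m v; have [r0 hr] := hrho (m, v); split.
- by move=> u; case: ifP => // _; rewrite le_max r0.
- by move=> u; rewrite ltNge => /negbTE ->.
- by move=> u ->; rewrite le_max lexx orbT.
move=> /hr[sum adm]; rewrite /= in sum; split; last first.
  move=> g gG near; apply: (le_trans (adm g gG)).
  apply: (le_trans (sum_undup_le (g.1 :: g.2) r0)).
  rewrite big_seq [leRHS]big_seq; apply: ler_sum => w /near.
  by rewrite ler_pdivlMr ?exprn_gt0 // => ->; rewrite le_max lexx.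
apply: (@le_trans _ _ (\sum_(u <- Y (m + k')) (powR (rho (m, v) u) p +
    powR delta p * (expR ((L + 1) * a ^+ k') * expR (- 1 * (d v u * a ^+ (m + k'))))))).
  apply: ler_sum => u _; case: ifP => [near|_]; last first.
    by rewrite powR0 ?gt_eqF // addr_ge0 ?powR_ge0 // !mulr_ge0 ?powR_ge0 ?expR_ge0.
  have E1 : 1 <= expR ((L + 1) * a ^+ k') * expR (- 1 * (d v u * a ^+ (m + k'))).
    rewrite -expRD -[leLHS]expR0 ler_expR mulN1r subr_ge0 exprD mulrA.
    by rewrite ler_pM2r // exprn_gt0.
  have dE : powR delta p <= powR delta p *
      (expR ((L + 1) * a ^+ k') * expR (- 1 * (d v u * a ^+ (m + k')))).
    by rewrite ler_peMr ?powR_ge0.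
  rewrite maxEle; case: ifP => _.
    by apply: (le_trans dE); rewrite lerDr powR_ge0.
  by rewrite lerDl mulr_ge0 ?powR_ge0 // mulr_ge0 ?expR_ge0.
rewrite big_split /= -mulr_sumr -mulr_sumr.
have : powR delta p * (expR ((L + 1) * a ^+ k') *
    \sum_(u <- Y (m + k')) expR (- 1 * (d v u * a ^+ (m + k')))) <= powR delta p * Cnt.
  apply: ler_wpM2l; first exact: powR_ge0.
  by rewrite /Cnt [leRHS]mulrC; apply: ler_wpM2l (M1P _ _); exact: expR_ge0.
by rewrite deltap; lra.
Qed.

(** The order of choices avoids circularity: [j] from [lam] and [L], then [M2] from [j], then [e]
    from [M1] and [M2], and last [k'], which the vanishing lower limit provides arbitrarily large
    with modulus below [e / 2]. *)
Lemma gauge_p_dimA_le (p : R) : 0 < p -> Mp d a lam Xs p L = 0%E ->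
  exists2 theta, gauge_p d theta & (dimA theta <= p%:E)%E.
Proof.
move=> p0 Mp0.
have Y0 : exists x, x \in Y 0%N.
  by have [x _] := Xne; have [u uY _] := Ycov 0 x; exists u.
have {Mp0}Mp0 := (limn_einf_eq0 (fun k => Mpk_ge0 d a lam L XsY Yuniq Y0 p k)).1 Mp0.
have [M1 M10 M1P] := exp_sum_bound dm a1 Yuniq Ysep C0 b0 ab ltr01.
have [j hj] : exists j, 2 * L + 6 <= (lam - 1) * a ^+ j.
  have h0 : 0 < (lam - 1) / (2 * L + 6).
    by rewrite divr_gt0 //; [have := lam1|have := L1]; lra.
  have [j /(_ j (leqnn _)) h] := exprV_small a1 h0; exists j.
  move: h; rewrite ler_pdivlMr; last by have := L1; lra.
  by rewrite mulrC ler_pdivrMr ?exprn_gt0.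
have aj0 : 0 < (2 * a ^+ j)^-1 by rewrite invr_gt0 mulr_gt0 // exprn_gt0.
have [M2 M20 M2P] := exp_sum_bound dm a1 Yuniq Ysep C0 b0 ab aj0.
pose Lr := L + 1; pose E := expR (1 + 2 * Lr).
have E0 : 0 < E by apply: expR_gt0.
pose e := (2 * E * (M1 + M2))^-1.
have e0 : 0 < e by rewrite invr_gt0 !mulr_gt0 // addr_gt0.
have e20 : 0 < e / 2 by lra.
have eE : e * E * (M1 + M2) = 2^-1.
  by rewrite /e; field; rewrite !gt_eqF // addr_gt0.
have eM1 : e * E * M1 <= 2^-1.
  by rewrite -eE mulrDr lerDl !mulr_ge0 // ltW.
have eM2 : e * E * M2 <= 2^-1.
  by rewrite -eE mulrDr lerDr !mulr_ge0 // ltW.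
have l0 : 0 < (4 + 2 * lam)^-1 by rewrite invr_gt0; have := lam1; lra.
have [K0 hK0] := exprV_small a1 l0.
(* [K0] ensures [4 + 2 * lam <= a ^+ k'], as the mass recursion and the elimination require; the 1
   makes [k] positive. *)
have [k' Kk' Mk'] := Mp0 (e / 2) (maxn K0 1) e20.
have ak'0 : 4 + 2 * lam <= a ^+ k'.
  have := hK0 k' (leq_trans (leq_maxl _ _) Kk').
  by rewrite lef_pV2 ?posrE ?exprn_gt0 //; have := lam1; lra.
have ak4 : 4 <= a ^+ k' by have := lam1; lra.
have ak2 : 2 * lam <= a ^+ k' by lra.
pose k := (k' + j)%N.
have k0 : (0 < k)%N by rewrite addn_gt0 (leq_trans _ Kk') // leq_maxr.
have [delta delta0 [rho' hrho]] := local_weights p0 e0 M10 M1P Mk'.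
pose rho n v u := rho' (k * n)%N v u.
have rho0 n v u : 0 <= rho n v u by have [h _ _ _] := hrho (k * n)%N v; exact: h.
have Lr1 : 1 <= Lr by rewrite /Lr; have := L1; lra.
have far n v u : v \in Y (k * n) -> Lr < d v u * a ^+ (k * n) -> rho n v u = 0.
  by move=> _; have [_ + _ _] := hrho (k * n)%N v; apply.
have near n v u : v \in Y (k * n) -> u \in Y (k * n + k') -> d v u * a ^+ (k * n) <= Lr ->
    delta <= rho n v u.
  by move=> _ _; have [_ _ + _] := hrho (k * n)%N v; apply.
have rsum n v : v \in Y (k * n) -> \sum_(u <- Y (k * n + k')) powR (rho n v u) p <= e.
  by have [_ _ _ +] := hrho (k * n)%N v; move=> h /h[].
have adm n v g : v \in Y (k * n) -> GammaKL d a lam Xs L k' v (k * n) g ->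
    {in g.1 :: g.2, forall w, d v w <= (L + 1) * a ^- (k * n)} ->
    1 <= \sum_(w <- g.1 :: g.2) rho n v w.
  by have [_ _ _ +] := hrho (k * n)%N v; move=> h /h[_ +]; apply.
have kE : k = (k' + j)%N by [].
have h2 : 0 <= 2^-1 :> R by rewrite invr_ge0.
pose pi := level_weight d a Y k k' p rho.
have pi_gt0 n x : 0 < pi n x := level_weight_gt0 dm a1 Ycov kE p0 Lr1 ak4 rho0 near delta0 n x.
have pi_0 x : pi 0%N x = 1 by rewrite /pi /level_weight /= powR1.
have harn := level_weight_harnack Y dm a1 rho kE p0.
have decay n x := level_weight_decay dm a1 kE p0 ak4 M1P far rsum e0 eM1 n x h2.
have growth := level_weight_growth dm a1 Ycov kE p0 Lr1 ak4 rho0 near delta0.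
have pi_step n z v u : v \in Y (k * n) -> u \in Y (k * n + k') ->
    d z u <= a ^- (k * n + k') -> pi n v * rho n v u <= pi n.+1 z.
  move=> vV uU zu; apply: level_weight_step => //.
  by rewrite -ler_pdivlMr ?exprn_gt0 // mul1r.
have elim := eliminate_levels dm a1 lam1 L1 XsY Ycov kE hj ak2 rho0
  (fun n x => ltW (pi_gt0 n x)) pi_step adm.
have mass m N x : \sum_(n < N) \sum_(z <- Y (k * (m + n)))
    expR (- 2 * (d x z * a ^+ (k * m))) * powR (pi (m + n) z) p <= 2 * M1 * powR (pi m x) p.
  have E1 n z : powR (pi n z) p = level_mass d a Y k k' p rho n z.
    exact: powR_level_weight.
  rewrite E1; under eq_bigr do under eq_bigr do rewrite E1.
  exact: (level_mass_total dm a1 kE p0 ak4 M1P M2P far rsum eM2).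
have q0 : 0 < p^-1 by rewrite invr_gt0.
have eta0 : 0 < powR 2^-1 p^-1 :> R by rewrite powR_gt0 // invr_gt0.
have eta1 : powR 2^-1 p^-1 < 1 :> R.
  have h3 : 2^-1 < 1 :> R by lra.
  apply: (@lt_le_trans _ _ (powR 1 p^-1)); last by rewrite powR1.
  by apply: gt0_ltr_powR; rewrite ?nnegrE.
have dl0 : 0 < powR (powR delta p * expR (- 2)) p^-1.
  by rewrite powR_gt0 // mulr_gt0 ?powR_gt0 ?expR_gt0.
have g1 : 1 <= L + 4 by have := L1; lra.
have c1 : 1 <= L + 2 by have := L1; lra.
have tm := chain_dist_metric dm a1 k0 g1 q0 eta0 eta1 pi_gt0 harn decay elim c1.
have pq := chain_dist_power_quasisymmetric dm a1 k0 g1 q0 eta0 eta1 dl0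
  dD pi_gt0 pi_0 harn decay growth elim c1.
have M20' : 0 < 2 * M1 by rewrite mulr_gt0.
have [C' C'0 ab'] := chain_dist_assouad dm a1 k0 g1 q0 eta0 eta1 dl0
  dD pi_gt0 pi_0 harn decay growth elim c1 Ycov p0 M20' mass.
exists (chain_dist d a k pi).
  by split=> //; split=> //; exact: power_quasisymmetric_quasisymmetric.
by apply: ge_ereal_inf; exists p%:E => //; exists p => //; split => //; exists C'.
Qed.

End LowerBound.

Theorem theorem1p2 (R : realType) (X : choiceType) (d : X -> X -> R) :
  (exists x : X, True) ->
  is_metric d -> d_compact d -> (dimA d < +oo)%E ->
  forall (a lam L : R) (Xs : nat -> set X),
    1 < a -> 1 < lam -> 1 < L ->
    (forall k : nat, maximal_separated d (a ^- k) (Xs k)) ->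
    dimCA d = CE d a lam Xs L /\
    CE d a lam Xs L = ereal_inf [set dimA theta | theta in gauge_p d].
Proof.
move=> Xne dm dc /assouad_bound_of_dimA[b [C [b0 C0 ab]]] a lam L Xs a1 lam1 L1 mx.
have a0 n : 0 < a ^- n by rewrite invr_gt0 exprn_gt0 // (lt_trans ltr01).
have [Dm dD] := compact_bounded dm dc.
have /choice[Y YP] : forall n, exists s : seq X, uniq s /\ Xs n = [set` s].
  move=> n; have [s us e] := separated_finite dm dc ab (a0 n) (mx n).1.
  by exists s.
have Yuniq n : uniq (Y n) by case: (YP n).
have XsY n : Xs n = [set` Y n] by case: (YP n).
have Ysep n : {in Y n &, forall u v, u <> v -> a ^- n <= d u v}.
  move=> u v uY vY; apply: (mx n).1; by rewrite XsY.
have Ycov n x : exists2 u, u \in Y n & d x u < a ^- n.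
  have [u uX xu] := maximal_separated_cover dm (a0 n) (mx n) x.
  by exists u => //; move: uX; rewrite XsY.
have Y0 : exists x, x \in Y 0%N.
  by have [x _] := Xne; have [u uY _] := Ycov 0%N x; exists u.
(* The three quantities are equal through the cycle of inequalities [h2], [h1], [h3]. *)
have h1 : (dimCA d <= ereal_inf [set dimA theta | theta in gauge_p d])%E.
  by apply: le_ereal_inf => _ [theta [tg _] <-]; exists theta.
have h2 : (CE d a lam Xs L <= dimCA d)%E.
  apply: le_ereal_inf_tmp => _ [theta tg <-].
  exact: (CE_le_dimA dm a1 lam1 L1 XsY Yuniq Ysep Y0 tg).
have h3 : (ereal_inf [set dimA theta | theta in gauge_p d] <= CE d a lam Xs L)%E.
  apply: le_ereal_inf_tmp => _ [p [p0 Mp0] <-].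
  have [theta tg le] := gauge_p_dimA_le dm a1 lam1 L1 XsY Yuniq Ysep Ycov Xne C0 b0 ab dD p0 Mp0.
  by apply: ge_ereal_inf; exists (dimA theta) => //; exists theta.
split; apply/le_anti/andP; split => //.
- exact: le_trans h1 h3.
- exact: le_trans h2 h1.
Qed.
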